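(* Let $p\ge5$ be a prime with Legendre symbol $\left(\frac{-3}{p}\right)=-1$, and let $m\ge0$, $\alpha\ge0$, $n\ge0$ be integers. Then for every $i\in\{1,2,\dots,p-1\}$, $$\overline{S}_9^{\,8m+1}\big(18p^{2\alpha+2}n+3(6i+p)p^{2\alpha+1}\big)\equiv0\pmod{16}.$$
   Context: For $|q|<1$ and a positive integer $k$, write $f_k=\prod_{j\ge1}(1-q^{kj})$. For a positive integer $r$, $\overline{S}_9^{\,r}(n)$ (number of $9$-Schur overpartitions of $n$ with $r$-tuples) is defined by $\sum_{n\ge0}\overline{S}_9^{\,r}(n)q^n=\prod_{n\ge1}\frac{(1+q^{2n-1})^r(1-q^{9(2n-1)})^r}{(1+q^{9(2n-1)})^r(1-q^{2n-1})^r}=\frac{f_2^{3r}f_9^{2r}f_{36}^r}{f_1^{2r}f_4^rf_{18}^{3r}}$. *)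

(* Defs.v *)
From HB Require Import structures.
From mathcomp Require Import all_boot all_order all_algebra.
From mathcomp Require Import boolp.

Set Implicit Arguments.
Unset Strict Implicit.
Unset Printing Implicit Defensive.

Import GRing.Theory.
Local Open Scope ring_scope.

(* The ring R[[q]] of formal power series, as coefficient sequences.  The
   classical eqType and choiceType structures are only there because the
   MathComp ring hierarchy asks for them. *)
Record fps (R : Type) := Fps { coefs :> nat -> R }.

HB.instance Definition _ (R : Type) := gen_eqMixin (fps R).
HB.instance Definition _ (R : Type) := gen_choiceMixin (fps R).

Lemma fpsP (R : Type) (f g : fps R) : (forall n, f n = g n) <-> f = g.
Proof.
split=> [|-> //]; case: f g => f [g] /= fg; congr Fps; exact/funext.
Qed.

Section FpsRing.
Variable R : comNzRingType.
Implicit Types f g h : fps R.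

Definition fps_zero : fps R := Fps (fun=> 0).
Definition fps_opp f : fps R := Fps (fun n => - f n).
Definition fps_add f g : fps R := Fps (fun n => f n + g n).
Definition fps_one : fps R := Fps (fun n => (n == 0)%:R).
Definition fps_mul f g : fps R := Fps (fun n => \sum_(i < n.+1) f i * g (n - i)%N).

Lemma fps_addA : associative fps_add.
Proof. by move=> f g h; apply/fpsP => n /=; rewrite addrA. Qed.
Lemma fps_addC : commutative fps_add.
Proof. by move=> f g; apply/fpsP => n /=; rewrite addrC. Qed.
Lemma fps_add0 : left_id fps_zero fps_add.
Proof. by move=> f; apply/fpsP => n /=; rewrite add0r. Qed.
Lemma fps_addN : left_inverse fps_zero fps_opp fps_add.
Proof. by move=> f; apply/fpsP => n /=; rewrite addNr. Qed.

HB.instance Definition _ :=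
  GRing.isZmodule.Build (fps R) fps_addA fps_addC fps_add0 fps_addN.

Definition fps_trunc N f : {poly R} := \poly_(i < N.+1) f i.

Lemma coef_fps_trunc N f i : (i <= N)%N -> (fps_trunc N f)`_i = f i.
Proof. by move=> iN; rewrite coef_poly ltnS iN. Qed.

Lemma fps_mul_trunc N f g n : (n <= N)%N ->
  fps_mul f g n = (fps_trunc N f * fps_trunc N g)`_n.
Proof.
move=> nN; rewrite coefM; apply: eq_bigr => i _.
rewrite !coef_fps_trunc //; first by rewrite (leq_trans (leq_subr _ _)).
by rewrite (leq_trans _ nN) // -ltnS.
Qed.

Lemma fps_mulC : commutative fps_mul.
Proof.
by move=> f g; apply/fpsP => n; rewrite !(fps_mul_trunc _ _ (leqnn n)) mulrC.
Qed.

Lemma fps_mulA : associative fps_mul.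
Proof.
move=> f g h; apply/fpsP => n.
transitivity ((fps_trunc n f * (fps_trunc n g * fps_trunc n h))`_n).
  rewrite coefM; apply: eq_bigr => i _.
  by rewrite coef_fps_trunc -1?ltnS // (@fps_mul_trunc n) ?leq_subr.
rewrite mulrA coefM; apply: eq_bigr => i _.
by rewrite coef_fps_trunc ?leq_subr // (@fps_mul_trunc n) // -ltnS.
Qed.

Lemma fps_mul1 : left_id fps_one fps_mul.
Proof.
move=> f; apply/fpsP => n /=; rewrite big_ord_recl /= mul1r subn0.
by rewrite big1 ?addr0 // => i _; rewrite mul0r.
Qed.

Lemma fps_mulDl : left_distributive fps_mul fps_add.
Proof.
move=> f g h; apply/fpsP => n /=; rewrite -big_split.
by apply: eq_bigr => i _; rewrite mulrDl.
Qed.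

Lemma fps_one_neq0 : fps_one != 0.
Proof.
by apply/eqP => /fpsP /(_ 0) /= /eqP; rewrite oner_eq0.
Qed.

HB.instance Definition _ := GRing.Zmodule_isComNzRing.Build (fps R)
  fps_mulA fps_mulC fps_mul1 fps_mulDl fps_one_neq0.

Definition fpsX : fps R := Fps (fun n => (n == 1)%:R).

Lemma coef_fps0 n : (0 : fps R) n = 0. Proof. by []. Qed.
Lemma coef_fps1 n : (1 : fps R) n = (n == 0)%:R. Proof. by []. Qed.
Lemma coef_fpsD f g n : (f + g) n = f n + g n. Proof. by []. Qed.
Lemma coef_fpsN f n : (- f) n = - f n. Proof. by []. Qed.
Lemma coef_fpsM f g n : (f * g) n = \sum_(i < n.+1) f i * g (n - i)%N.
Proof. by []. Qed.

Lemma coef_fpsXM f n : (fpsX * f) n = if n is n'.+1 then f n' else 0.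
Proof.
rewrite coef_fpsM big_ord_recl /= mul0r add0r.
case: n => [|n]; first by rewrite big_ord0.
rewrite big_ord_recl /= mul1r subSS subn0 big1 ?addr0 // => i _.
by rewrite mul0r.
Qed.

Lemma coef_fpsXn d n : (fpsX ^+ d) n = (n == d)%:R.
Proof.
elim: d n => [|d IH] n; first by rewrite expr0 coef_fps1.
by rewrite exprS coef_fpsXM; case: n => [|n]; rewrite // IH.
Qed.

End FpsRing.

Arguments fpsX {R}.
Notation "''q'" := (fpsX : fps _) (at level 0) : ring_scope.

Section FpsUnitRing.
Variable R : comUnitRingType.
Implicit Types f g h : fps R.

(* the list of the first n coefficients of 1 / f, obtained by solving
   \sum_(i <= k) f i * g (k - i) = (k == 0) for g k *)
Fixpoint fps_inv_coefs f n : seq R :=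
  if n is k.+1 then
    let s := fps_inv_coefs f k in
    rcons s ((f 0)^-1 * ((k == 0)%:R - \sum_(i < k) f i.+1 * s`_(k - i.+1)))
  else [::].

Definition fps_unit : pred (fps R) := fun f => f 0 \is a GRing.unit.
Definition fps_inv f : fps R :=
  if fps_unit f then Fps (fun n => (fps_inv_coefs f n.+1)`_n) else f.

Lemma size_fps_inv_coefs f n : size (fps_inv_coefs f n) = n.
Proof. by elim: n => //= n IH; rewrite size_rcons IH. Qed.

Lemma nth_fps_inv_coefs f n k : (k < n)%N ->
  (fps_inv_coefs f n)`_k = (fps_inv_coefs f k.+1)`_k.
Proof.
elim: n => // n IH; rewrite ltnS leq_eqVlt => /orP[/eqP-> //|kn].
by rewrite -IH //= nth_rcons size_fps_inv_coefs kn.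
Qed.

Lemma fps_mulVf : {in fps_unit, left_inverse 1 fps_inv *%R}.
Proof.
move=> f Uf; have Uf' : fps_unit f by [].
rewrite mulrC; apply/fpsP => n; rewrite /fps_inv Uf' coef_fpsM coef_fps1.
rewrite big_ord_recl subn0 [X in _ * X + _]/= nth_rcons size_fps_inv_coefs.
rewrite ltnn eqxx mulrA divrr // mul1r.
rewrite -[RHS](subrK (\sum_(i < n) f i.+1 * (fps_inv_coefs f n)`_(n - i.+1))).
congr (_ + _); apply: eq_bigr => i _ /=; congr (_ * _).
rewrite [RHS](@nth_fps_inv_coefs _ n) // -subSn // subSS; exact: leq_subr.
Qed.

Lemma fps_unitPl f g : g * f = 1 -> fps_unit f.
Proof.
move=> /fpsP /(_ 0); rewrite coef_fpsM big_ord1 coef_fps1 subn0 => gf1.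
by apply/unitrP; exists (g 0); rewrite [f 0 * _]mulrC.
Qed.

Lemma fps_inv_out : {in [predC fps_unit], fps_inv =1 id}.
Proof.
move=> f; rewrite inE => /negbTE nU; rewrite /fps_inv.
by rewrite -[fps_unit f]/(f \in fps_unit) nU.
Qed.

HB.instance Definition _ := GRing.ComNzRing_hasMulInverse.Build (fps R)
  fps_mulVf fps_unitPl fps_inv_out.

End FpsUnitRing.

Definition fps_cvg (R : Type) (u : nat -> fps R) (f : fps R) : Prop :=
  forall n, exists N, forall M, (N <= M)%N -> u M n = f n.

(* The infinite product \prod_(j >= 1) F j, meaningful when F j = 1 mod q^j:
   the coefficient of q^n then only depends on the factors with j <= n
   (fps_iprod_cvg). *)
Definition fps_iprod (R : comNzRingType) (F : nat -> fps R) : fps R :=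
  Fps (fun n => (\prod_(1 <= j < n.+1) F j) n).

Definition fps_eq1 (R : comNzRingType) (d : nat) (f : fps R) : Prop :=
  forall n, (n < d)%N -> f n = (n == 0)%:R.

Section InfiniteProduct.
Variable R : comNzRingType.
Implicit Types f g : fps R.

Lemma fps_mul_eq1 d f g n : fps_eq1 d g -> (n < d)%N -> (f * g) n = f n.
Proof.
move=> g1 nd; rewrite coef_fpsM big_ord_recr /= subnn g1 ?(leq_ltn_trans _ nd) //.
rewrite mulr1 big1 ?add0r // => i _; rewrite g1.
  by rewrite subn_eq0 leqNgt ltn_ord mulr0.
exact: leq_ltn_trans (leq_subr _ _) nd.
Qed.

Lemma fps_iprod_coef (F : nat -> fps R) n N :
  (forall j, (0 < j)%N -> fps_eq1 j (F j)) -> (n <= N)%N ->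
  (\prod_(1 <= j < N.+1) F j) n = fps_iprod F n.
Proof.
move=> F1; elim: N => [|N IH]; first by rewrite leqn0 => /eqP->.
rewrite leq_eqVlt => /orP[/eqP-> //|]; rewrite ltnS => nN.
by rewrite big_nat_recr // (@fps_mul_eq1 N.+1) ?IH //; exact: F1.
Qed.

Lemma fps_iprod_cvg (F : nat -> fps R) :
  (forall j, (0 < j)%N -> fps_eq1 j (F j)) ->
  fps_cvg (fun N => \prod_(1 <= j < N.+1) F j) (fps_iprod F).
Proof. by move=> F1 n; exists n => N nN; exact: fps_iprod_coef. Qed.

Lemma fps_eq1M d f g : fps_eq1 d f -> fps_eq1 d g -> fps_eq1 d (f * g).
Proof. by move=> f1 g1 n nd; rewrite (@fps_mul_eq1 d) ?f1. Qed.

Lemma fps_eq1X d f r : fps_eq1 d f -> fps_eq1 d (f ^+ r).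
Proof.
move=> f1; elim: r => [|r IH]; first by move=> n _; rewrite expr0 coef_fps1.
by rewrite exprS; exact: fps_eq1M.
Qed.

Lemma fps_eq1_addXn d e : (d <= e)%N -> fps_eq1 d (1 + 'q ^+ e : fps R).
Proof.
move=> de n nd; rewrite coef_fpsD coef_fps1 coef_fpsXn.
by rewrite (ltn_eqF (leq_trans nd de)) addr0.
Qed.

Lemma fps_eq1_subXn d e : (d <= e)%N -> fps_eq1 d (1 - 'q ^+ e : fps R).
Proof.
move=> de n nd; rewrite coef_fpsD coef_fpsN coef_fps1 coef_fpsXn.
by rewrite (ltn_eqF (leq_trans nd de)) subr0.
Qed.

End InfiniteProduct.

Lemma fps_eq1V (R : comUnitRingType) d (f : fps R) :
  fps_eq1 d f -> fps_eq1 d f^-1.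
Proof.
case: d => [|d] f1 n nd; first by [].
have Uf : f \is a GRing.unit by rewrite qualifE /= /fps_unit f1 // unitr1.
by rewrite -(@fps_mul_eq1 _ d.+1 _ f) // mulVr.
Qed.

Definition schur9_factor (r j : nat) : fps int :=
  ((1 + 'q ^+ (2 * j - 1)) ^+ r * (1 - 'q ^+ (9 * (2 * j - 1))) ^+ r) /
  ((1 + 'q ^+ (9 * (2 * j - 1))) ^+ r * (1 - 'q ^+ (2 * j - 1)) ^+ r).

Definition schur9_gen (r : nat) : fps int := fps_iprod (schur9_factor r).

Lemma schur9_gen_cvg (r : nat) :
  fps_cvg (fun N => \prod_(1 <= j < N.+1) schur9_factor r j) (schur9_gen r).
Proof.
apply: fps_iprod_cvg => j j0.
have le1 : (j <= 2 * j - 1)%N by rewrite mul2n -addnn -addnBA // leq_addr.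
have le9 : (j <= 9 * (2 * j - 1))%N by rewrite (leq_trans le1) // leq_pmull.
apply: fps_eq1M; last apply: fps_eq1V; apply: fps_eq1M; apply: fps_eq1X;
  solve [exact: fps_eq1_addXn | exact: fps_eq1_subXn].
Qed.

(* the number of 9-Schur overpartitions of n with r-tuples *)
Definition schur9 (r n : nat) : int := schur9_gen r n.

(* meant for p an odd prime ('F_p is Z/pZ only when p is prime) *)
Definition legendre (a : int) (p : nat) : int :=
  if (p %| a)%Z then 0
  else if [exists x : 'F_p, x ^+ 2 == a%:~R] then 1 else -1.

(* Main.v *)
Require Import Defs.
From mathcomp Require Import all_boot all_order all_algebra all_field.
From mathcomp Require Import zify ring.

(** Write T_d = 1 + 2 \sum_(c >= 1) (-1)^c q^(d c^2). Gauss's product formula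
    for T_d, obtained from a telescoping sum, gives G T_1 T_18 = T_2 T_9 for
    the generating function G with r = 1, and G = 1 mod 2 implies
    G^(8m+1) = G mod 16. Splitting off the exponents divisible by 3,
    T_1 = T_9 - 2U and T_2 = T_18 - 2U', so G can be expanded modulo 16; the
    part with exponents in 3Z is 1 + 4UU' - 8UU'(s + s'), where T_9 = 1 + 2s
    and T_18 = 1 + 2s'.

    The index of the coefficient is 3M with M = p^(2 alpha + 1) k, and both p^(2 alpha + 1) and
    k are odd and 2 mod 3. The coefficient of q^(3M) in UU' is, up to sign,
    twice the number of x, y > 0 with x^2 + 2y^2 = M, and the coefficients of
    UU's and UU's' have the parity of the number of representations of M
    by x^2 + 3y^2 and x^2 + 6y^2. The form x^2 + 3y^2 does not represent M, and
    for D = 2, 6 the representations by x^2 + D y^2 come in pairs: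
    x + y sqrt(-D) goes to the number obtained by conjugating its factor of
    norm k only. For D = 6 the class number is 2, but this partner is again of
    the form u + v sqrt(-6) since everything happens in the principal genus. *)

Set Implicit Arguments.
Unset Strict Implicit.
Unset Printing Implicit Defensive.

Import GRing.Theory.
Local Open Scope ring_scope.

(** * A finite form of Gauss's product formula *)

Section GaussTelescoping.
Variables (R : comPzRingType) (x : R) (I : nat -> R).

(* [I n] plays the role of the inverse of the q-Pochhammer symbol
   (x; x)_n = \prod_(1 <= j <= n) (1 - x ^+ j). *)
Hypotheses (I0 : I 0 = 1) (IS : forall n, I n = (1 - x ^+ n.+1) * I n.+1).

Definition gauss_term N k : R :=
  (- 1) ^+ k * x ^+ (k ^ 2) * (I (N - k) * I (N + k)).

(** The sum of (-1)^k x^(k^2) / ((x; x)_(N-k) (x; x)_(N+k)) over -N <= k <= N, folded by k -> -k. *)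
Definition gauss_sum N : R :=
  gauss_term N 0 + 2 * \sum_(1 <= k < N.+1) gauss_term N k.

(* The differences of [gauss_step] are those of the telescoping sum which
   proves the recurrence (1 - x ^+ 2N) S_N = S_(N-1). *)
Definition gauss_step N k : R :=
  (- 1) ^+ k * x ^+ (k ^ 2 + N - k) * (I (N - k) * I (N + k).-1).

(** With d = N - k, a = x^(d+1) and b = x^(2k+d+1), everything is a multiple of
    [I d.+1 * I (2 * k + d).+1], and the identity is 1 - ab = (1 - a)(1 - b) + a(1 - b) + b(1 -
    a). *)
Lemma gauss_term_rec N k : (k <= N)%N ->
  (1 - x ^+ (2 * N.+1)) * gauss_term N.+1 k =
  gauss_term N k + gauss_step N.+1 k - gauss_step N.+1 k.+1.
Proof.
move=> kN; rewrite /gauss_term /gauss_step.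
have [d ->] : exists d, N = (k + d)%N by exists (N - k)%N; lia.
have -> : ((k + d).+1 - k = d.+1)%N by lia.
have -> : (k + d - k = d)%N by lia.
have -> : ((k + d).+1 - k.+1 = d)%N by lia.
have -> : ((k + d).+1 + k = (2 * k + d).+1)%N by lia.
have -> : (k + d + k = 2 * k + d)%N by lia.
have -> : ((k + d).+1 + k.+1).-1 = (2 * k + d).+1 by lia.
have -> : (k ^ 2 + (k + d).+1 - k = k ^ 2 + d.+1)%N by lia.
have -> : (k.+1 ^ 2 + (k + d).+1 - k.+1 = k ^ 2 + (2 * k + d).+1)%N.
  by rewrite -!mulnn; lia.
have -> : (2 * (k + d).+1 = (2 * k + d).+1 + d.+1)%N by lia.
rewrite [(2 * k + d).+1.-1]/= (IS d) (IS (2 * k + d)) !exprD !exprS.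
ring.
Qed.

(** Sum [gauss_term_rec] over k. The new term k = N + 1 cancels the upper boundary of the
    telescoping sum; the term k = 0 cancels the lower one, since [gauss_step] only changes sign
    between k = 0 and k = 1. *)
Lemma gauss_sumS N : (1 - x ^+ (2 * N.+1)) * gauss_sum N.+1 = gauss_sum N.
Proof.
rewrite /gauss_sum big_nat_recr //= mulrDr gauss_term_rec // mulrCA mulrDr.
rewrite mulr_sumr.
have -> : \sum_(1 <= k < N.+1) (1 - x ^+ (2 * N.+1)) * gauss_term N.+1 k =
    \sum_(1 <= k < N.+1)
      (gauss_term N k + (gauss_step N.+1 k - gauss_step N.+1 k.+1)).
  by apply: eq_big_nat => k /andP[_ kN]; rewrite gauss_term_rec // addrA.
rewrite big_split /=.
have -> : \sum_(1 <= k < N.+1) (gauss_step N.+1 k - gauss_step N.+1 k.+1)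
          = gauss_step N.+1 1 - gauss_step N.+1 N.+1.
  rewrite -[RHS]opprB -(telescope_sumr (gauss_step N.+1)) // -sumrN.
  by apply: eq_bigr => k _; rewrite opprB.
have -> : (1 - x ^+ (2 * N.+1)) * gauss_term N.+1 N.+1 = gauss_step N.+1 N.+1.
  rewrite /gauss_term /gauss_step subnn I0 !mul1r addnK.
  have -> : (N.+1 + N.+1 = (2 * N.+1).-1.+1)%N by lia.
  rewrite (IS (2 * N.+1).-1) (_ : (2 * N.+1).-1.+1 = (2 * N.+1)%N); last by lia.
  ring.
have -> : gauss_step N.+1 0 = - gauss_step N.+1 1.
  rewrite /gauss_step !subn0 subSS subn0 addn1 addn0 /= add0n !expr0 expr1.
  rewrite exp1n add1n subSS subn0 mulN1r mul1r mulNr opprK; ring.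
ring.
Qed.

Lemma gauss_sum_prod N :
  (\prod_(1 <= j < N.+1) (1 - x ^+ (2 * j))) * gauss_sum N = 1.
Proof.
elim: N => [|N IH].
  rewrite big_geq // /gauss_sum big_geq // /gauss_term /= I0 !expr0; ring.
by rewrite big_nat_recr //= -mulrA gauss_sumS.
Qed.

End GaussTelescoping.

(** * Power series modulo q^(N+1) *)

Section TruncatedEquality.
Variable R : comNzRingType.
Implicit Types f g h : fps R.

Lemma coef_fps_sum (I : Type) (r : seq I) (P : pred I) (F : I -> fps R) n :
  (\sum_(i <- r | P i) F i) n = \sum_(i <- r | P i) F i n.
Proof. by apply: (big_morph (fun f : fps R => f n)) => // f g. Qed.

Lemma coef_fpsMn f k n : (f *+ k) n = f n *+ k.
Proof. by elim: k => // k IH; rewrite !mulrS coef_fpsD IH. Qed.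

Lemma coef_fps_intrM (z : int) f n : (z%:~R * f) n = z%:~R * f n.
Proof.
rewrite !mulrzl; case: z => k; first exact: coef_fpsMn.
by rewrite !NegzE !mulrNz coef_fpsN -!pmulrn coef_fpsMn.
Qed.

Definition fps_eqn N f g := forall n, (n <= N)%N -> f n = g n.

Lemma fps_eqn_refl N f : fps_eqn N f f. Proof. by []. Qed.

Lemma fps_eqn_sym N f g : fps_eqn N f g -> fps_eqn N g f.
Proof. by move=> fg n nN; rewrite fg. Qed.

Lemma fps_eqn_trans N f g h : fps_eqn N f g -> fps_eqn N g h -> fps_eqn N f h.
Proof. by move=> fg gh n nN; rewrite fg // gh. Qed.

Lemma fps_eqnW N N' f g : (N <= N')%N -> fps_eqn N' f g -> fps_eqn N f g.
Proof. by move=> NN' fg n nN; apply: fg; exact: leq_trans NN'. Qed.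

Lemma fps_eqnD N f g f' g' :
  fps_eqn N f g -> fps_eqn N f' g' -> fps_eqn N (f + f') (g + g').
Proof. by move=> fg fg' n nN; rewrite !coef_fpsD fg ?fg'. Qed.

Lemma fps_eqnM N f g f' g' :
  fps_eqn N f g -> fps_eqn N f' g' -> fps_eqn N (f * f') (g * g').
Proof.
move=> fg fg' n nN; rewrite !coef_fpsM; apply: eq_bigr => i _.
rewrite fg ?fg' //; first exact: leq_trans (leq_subr _ _) nN.
by rewrite (leq_trans _ nN) // -ltnS.
Qed.

Lemma fps_eqnMl N f g h : fps_eqn N g h -> fps_eqn N (f * g) (f * h).
Proof. exact: fps_eqnM. Qed.

Lemma fps_eqn_sum N (I : eqType) (r : seq I) (F G : I -> fps R) :
  (forall i, i \in r -> fps_eqn N (F i) (G i)) ->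
  fps_eqn N (\sum_(i <- r) F i) (\sum_(i <- r) G i).
Proof.
move=> FG n nN; rewrite !coef_fps_sum.
by apply: eq_big_seq => i ir; exact: FG.
Qed.

(** The factor q^e supplies e orders of precision, so f may be 1 to a lower order. In
    [gauss_theta_prod], f is a quotient of Pochhammer symbols. *)
Lemma fps_eqn_XnM N d e f :
  (N < d + e)%N -> fps_eq1 d f -> fps_eqn N ('q ^+ e * f) ('q ^+ e).
Proof.
move=> Nde f1 n nN; rewrite coef_fpsM coef_fpsXn.
have [ne|en] := ltnP n e.
  rewrite (ltn_eqF ne) big1 // => i _; rewrite coef_fpsXn ltn_eqF ?mul0r //.
  by rewrite (leq_trans (ltn_ord i)).
rewrite (bigD1 (Ordinal (en : (e < n.+1)%N))) //= coef_fpsXn eqxx mul1r.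
rewrite f1; last by lia.
rewrite big1 ?addr0 => [|i /negP ie]; first by congr (_%:R); lia.
rewrite coef_fpsXn; case: eqP => [ie'|]; last by rewrite mul0r.
by case: ie; apply/eqP/val_inj.
Qed.

End TruncatedEquality.

Section TruncatedCancel.
Variable R : comUnitRingType.
Implicit Types f g u : fps R.

Lemma fps_eqn_cancel N u f g : u \is a GRing.unit ->
  fps_eqn N (u * f) (u * g) -> fps_eqn N f g.
Proof. by move=> Uu /(@fps_eqnMl _ N u^-1); rewrite !mulKr. Qed.

Lemma fps_eq1_unit d f : fps_eq1 d.+1 f -> f \is a GRing.unit.
Proof. by move=> f1; rewrite qualifE /= /fps_unit f1 // unitr1. Qed.

Lemma fps_eq1_prod d (F : nat -> fps R) m n :
  (forall j, (m <= j < n)%N -> fps_eq1 d (F j)) ->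
  fps_eq1 d (\prod_(m <= j < n) F j).
Proof.
move=> F1; rewrite big_seq; apply: (big_ind (fps_eq1 d)) => //.
  exact: fps_eq1M.
by move=> j; rewrite mem_index_iota; exact: F1.
Qed.

Lemma prod_addXn_unit d m : (0 < d)%N ->
  \prod_(1 <= j < m) (1 + 'q ^+ (d * j) : fps R) \is a GRing.unit.
Proof.
move=> d0; apply: (@fps_eq1_unit 0); apply: fps_eq1_prod => j /andP[j0 _].
by apply: fps_eq1_addXn; rewrite muln_gt0 d0.
Qed.

Lemma prod_subXn_unit d m : (0 < d)%N ->
  \prod_(1 <= j < m) (1 - 'q ^+ (d * j) : fps R) \is a GRing.unit.
Proof.
move=> d0; apply: (@fps_eq1_unit 0); apply: fps_eq1_prod => j /andP[j0 _].
by apply: fps_eq1_subXn; rewrite muln_gt0 d0.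
Qed.

End TruncatedCancel.

(** * Theta series and Gauss's product formula *)

Definition square_series (w : nat -> int) d : fps int :=
  Fps (fun n => \sum_(1 <= c < n.+1 | (d * c ^ 2 == n)%N) w c).

Lemma square_series_trunc w d N : (0 < d)%N ->
  fps_eqn N (square_series w d)
    (\sum_(1 <= c < N.+1) (w c)%:~R * 'q ^+ (d * c ^ 2)).
Proof.
move=> d0 n nN; rewrite coef_fps_sum [LHS]/= big_mkcond [LHS]/=.
rewrite [RHS](@big_cat_nat _ _ _ n.+1) //.
rewrite [X in _ = _ + X]big_nat_cond [X in _ = _ + X]big1 ?addr0.
  apply: eq_bigr => c _.
  by rewrite coef_fps_intrM coef_fpsXn eq_sym intz; case: eqP; rewrite ?mulr1 ?mulr0.
move=> c /andP[/andP[nc _] _]; rewrite coef_fps_intrM coef_fpsXn ltn_eqF ?mulr0 //.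
by rewrite (leq_trans nc) // -mulnn; nia.
Qed.

Definition alt_sign c : int := (- 1) ^+ c.

(** The series T_d, which is Ramanujan's phi(-q^d). *)
Definition gauss_theta d : fps int := 1 + 2 * square_series alt_sign d.

(** For x = q^d, the finite sum times (x; x)_N^2 agrees with T_d up to q^N, and its value 1 / (x^2;
    x^2)_N then becomes the quotient of the two products. *)
Lemma gauss_theta_prod d N : (0 < d)%N ->
  fps_eqn N (gauss_theta d * \prod_(1 <= j < N.+1) (1 + 'q ^+ (d * j)))
    (\prod_(1 <= j < N.+1) (1 - 'q ^+ (d * j))).
Proof.
move=> d0; pose P n : fps int := \prod_(1 <= j < n.+1) (1 - 'q ^+ (d * j)).
have UP n : P n \is a GRing.unit by exact: prod_subXn_unit.
pose x : fps int := 'q ^+ d; pose I n := (P n)^-1.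
have I0 : I 0 = 1 by rewrite /I /P big_geq // invr1.
have PS n : P n.+1 = P n * (1 - x ^+ n.+1).
  by rewrite /P big_nat_recr //= exprM.
have IS n : I n = (1 - x ^+ n.+1) * I n.+1.
  apply: (mulrI (UP n)); rewrite mulrA -PS /I mulrV // mulrV //.
have Ptail n k : fps_eq1 n.+1 (P (n + k)%N * I n).
  rewrite /P /I (@big_cat_nat _ _ _ n.+1) //=; last by lia.
  rewrite mulrC mulrA mulVr // mul1r; apply: fps_eq1_prod => j /andP[nj _].
  by apply: fps_eq1_subXn; rewrite (leq_trans nj) // leq_pmull.
have eqS : fps_eqn N (P N * P N * gauss_sum x I N) (gauss_theta d).
  rewrite /gauss_sum mulrDr; apply: fps_eqnD.
    rewrite /gauss_term expr0 !mul1r subn0 addn0 /I.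
    by rewrite mulrA mulrK ?mulrV.
  rewrite mulrCA; apply: fps_eqnMl; rewrite mulr_sumr.
  apply: fps_eqn_trans; last by apply: fps_eqn_sym; exact: square_series_trunc.
  apply: fps_eqn_sum => k; rewrite mem_index_iota => /andP[k0 kN].
  rewrite /gauss_term /x -exprM.
  have -> : P N * P N * ((-1) ^+ k * 'q ^+ (d * k ^ 2) * (I (N - k)%N * I (N + k)%N))
    = (-1) ^+ k * ('q ^+ (d * k ^ 2) * ((P N * I (N - k)%N) * (P N * I (N + k)%N))).
    by rewrite -!mulrA; ring.
  rewrite rmorphXn /= rmorphN1; apply: fps_eqnMl.
  (* Both Pochhammer quotients are 1 modulo q^(N-k+1), and d k^2 >= k. *)
  apply: (@fps_eqn_XnM _ _ (N - k).+1); first by rewrite -mulnn; nia.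
  apply: fps_eq1M.
    by have := @Ptail (N - k)%N k; rewrite subnK.
  have := fps_eq1V (@Ptail N k); rewrite invrM ?unitrV // /I invrK => H.
  by move=> n nNk; rewrite H //; lia.
have prod2 : \prod_(1 <= j < N.+1) (1 - x ^+ (2 * j)) =
    P N * \prod_(1 <= j < N.+1) (1 + 'q ^+ (d * j)).
  rewrite /P -big_split /=; apply: eq_bigr => j _.
  by rewrite /x -exprM -subr_sqr expr1n -exprM; congr (1 - _ ^+ _); lia.
have := gauss_sum_prod I0 IS N; rewrite prod2 => gP.
apply: (fps_eqn_cancel (UP N)); rewrite mulrCA.
apply: fps_eqn_trans (fps_eqnM (fps_eqn_sym eqS) (fps_eqn_refl _)) _.
move=> n _; congr (coefs _ n).
rewrite -/(P N); set A := \prod_(_ <= j < _) _ in gP *.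
transitivity (P N * P N * (P N * A * gauss_sum x I N)); first by ring.
by rewrite gP mulr1.
Qed.

(** * The generating function as a quotient of theta series *)

Lemma schur9_factor_eq1 r j : (0 < j)%N -> fps_eq1 j (schur9_factor r j).
Proof.
move=> j0; rewrite /schur9_factor.
by apply: fps_eq1M; last apply: fps_eq1V; apply: fps_eq1M; apply: fps_eq1X;
  first [apply: fps_eq1_addXn | apply: fps_eq1_subXn]; lia.
Qed.

Lemma schur9_gen_trunc r N :
  fps_eqn N (schur9_gen r) (\prod_(1 <= j < N.+1) schur9_factor r j).
Proof.
by move=> n nN; rewrite (fps_iprod_coef (@schur9_factor_eq1 r) nN).
Qed.

Lemma schur9_gen_exp r : schur9_gen r = schur9_gen 1 ^+ r.
Proof.
have factorX j : schur9_factor r j = schur9_factor 1 j ^+ r.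
  by rewrite /schur9_factor !expr1 !exprMn exprVn exprMn.
apply/fpsP => n; transitivity ((\prod_(1 <= j < n.+1) schur9_factor 1 j ^+ r) n).
  by rewrite [LHS]/=; congr (coefs _ n); apply: eq_bigr => j _.
rewrite prodrXl; elim: r {factorX} n => [|r IH] n; first by rewrite !expr0.
rewrite !exprS; apply: (@fps_eqnM _ n) => // k kn; last first.
  rewrite -IH -!prodrXl (fps_iprod_coef _ kn) // => j j0.
  by apply: fps_eq1X; exact: schur9_factor_eq1.
by rewrite (@schur9_gen_trunc 1 n k kn).
Qed.

Section OddProducts.
Variable N : nat.

Definition odd_add d : fps int := \prod_(1 <= j < N.+1) (1 + 'q ^+ (d * (2 * j - 1))).
Definition odd_sub d : fps int := \prod_(1 <= j < N.+1) (1 - 'q ^+ (d * (2 * j - 1))).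

Lemma prod_odd_even (R : comPzRingType) (F : nat -> R) n :
  \prod_(1 <= j < (2 * n).+1) F j =
  (\prod_(1 <= j < n.+1) F (2 * j - 1)%N) * \prod_(1 <= j < n.+1) F (2 * j)%N.
Proof.
elim: n => [|n IH]; first by rewrite !big_geq // mulr1.
rewrite (_ : (2 * n.+1).+1 = (2 * n).+3); last by lia.
rewrite [LHS]big_nat_recr // [X in X * _ = _]big_nat_recr // IH.
rewrite [in RHS]big_nat_recr // [X in _ = _ * X]big_nat_recr //=.
rewrite (_ : (2 * n.+1 - 1 = (2 * n).+1)%N); last by lia.
rewrite (_ : (2 * n.+1 = (2 * n).+2)%N); last by lia.
ring.
Qed.

Lemma odd_add_unit d : (0 < d)%N -> odd_add d \is a GRing.unit.
Proof.
move=> d0; apply: (@fps_eq1_unit _ 0); apply: fps_eq1_prod => j /andP[j0 _].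
by apply: fps_eq1_addXn; nia.
Qed.

Lemma odd_sub_unit d : (0 < d)%N -> odd_sub d \is a GRing.unit.
Proof.
move=> d0; apply: (@fps_eq1_unit _ 0); apply: fps_eq1_prod => j /andP[j0 _].
by apply: fps_eq1_subXn; nia.
Qed.

(** In Gauss's formula for T_d, taken up to j = 2N, the factors with even j are the two products of
    the formula for T_(2d); they are replaced by T_(2d) and cancelled. *)
Lemma gauss_theta_odd d : (0 < d)%N ->
  fps_eqn N (gauss_theta d * odd_add d) (gauss_theta (2 * d) * odd_sub d).
Proof.
move=> d0; have d20 : (0 < 2 * d)%N by rewrite muln_gt0.
have := fps_eqnW (leq_addl N N) (@gauss_theta_prod d (N + N) d0).
rewrite (_ : (N + N = 2 * N)%N); last by lia.
rewrite !prod_odd_even.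
have even_prod (e : fps int) : \prod_(1 <= j < N.+1) (1 + e * 'q ^+ (d * (2 * j)))
    = \prod_(1 <= j < N.+1) (1 + e * 'q ^+ (2 * d * j)).
  by apply: eq_bigr => j _; congr (_ + _ * _ ^+ _); lia.
have := even_prod 1; have := even_prod (- 1).
under eq_bigr => j _ do rewrite mulN1r.
under [X in _ = X -> _]eq_bigr => j _ do rewrite mulN1r.
move=> ->.
under eq_bigr => j _ do rewrite mul1r.
under [X in _ = X -> _]eq_bigr => j _ do rewrite mul1r.
move=> -> H.
apply: (fps_eqn_cancel (prod_addXn_unit _ N.+1 d20)).
rewrite mulrC -mulrA; apply: fps_eqn_trans H _.
rewrite mulrCA mulrA [_ * odd_sub d]mulrC; apply: fps_eqnMl.
by apply: fps_eqn_sym; exact: gauss_theta_prod.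
Qed.

End OddProducts.

(** The odd products of G are exchanged for T_2 / T_1 and T_9 / T_18 by [gauss_theta_odd] with d = 1
    and d = 9, the second one read backwards. *)
Lemma schur9_gen_theta :
  schur9_gen 1 * gauss_theta 1 * gauss_theta 18 = gauss_theta 2 * gauss_theta 9.
Proof.
suff eqG N : fps_eqn N (schur9_gen 1 * gauss_theta 1 * gauss_theta 18)
  (gauss_theta 2 * gauss_theta 9) by apply/fpsP => n; exact: eqG (leqnn n).
have U1 : odd_sub N 1 \is a GRing.unit by exact: odd_sub_unit.
have U9 : odd_add N 9 \is a GRing.unit by exact: odd_add_unit.
have G_odd : fps_eqn N (schur9_gen 1 * (odd_sub N 1 * odd_add N 9))
    (odd_add N 1 * odd_sub N 9).
  apply: fps_eqn_trans (fps_eqnM (@schur9_gen_trunc 1 N) (@fps_eqn_refl _ N _)) _.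
  move=> n _; congr (coefs _ n); rewrite /odd_sub /odd_add -!big_split /=.
  rewrite big_nat [RHS]big_nat; apply: eq_bigr => j /andP[j0 _].
  rewrite /schur9_factor !expr1 !mul1n [(1 - _) * (1 + _)]mulrC divrK //.
  apply: (@fps_eq1_unit _ 0); apply: fps_eq1M.
    by apply: fps_eq1_addXn; lia.
  by apply: fps_eq1_subXn; lia.
have U : odd_sub N 1 * odd_add N 9 \is a GRing.unit by rewrite unitrM U1.
apply: (fps_eqn_cancel U).
have := fps_eqnM (@gauss_theta_odd N 1 isT) (fps_eqn_sym (@gauss_theta_odd N 9 isT)).
move=> H.
rewrite [X in fps_eqn N X _](_ : _ = (schur9_gen 1 * (odd_sub N 1 * odd_add N 9)) *
  (gauss_theta 1 * gauss_theta 18)); last by ring.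
apply: fps_eqn_trans (fps_eqnM G_odd (@fps_eqn_refl _ N _)) _.
rewrite [X in fps_eqn N X _](_ : _ = gauss_theta 1 * odd_add N 1 *
  (gauss_theta (2 * 9) * odd_sub N 9)); last by rewrite (_ : (2 * 9 = 18)%N) //; ring.
apply: fps_eqn_trans H _ => n _; congr (coefs _ n); rewrite muln1; ring.
Qed.

(** * The theta quotient modulo 16 *)

Section ModSixteen.
Variable R : comPzRingType.
Implicit Types a s U V W G : R.

(** Here and in the next two lemmas the witness is what remains of the binomial expansion, divided
    by 16, 4 and 2. *)
Lemma one_add2_exp8 s : exists A : R, (1 + 2 * s) ^+ 8 = 1 + 16 * A.
Proof.
exists (s + 7 * s ^+ 2 + 28 * s ^+ 3 + 70 * s ^+ 4 + 112 * s ^+ 5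
  + 112 * s ^+ 6 + 64 * s ^+ 7 + 16 * s ^+ 8); ring.
Qed.

Lemma one_add2_exp7 s : exists A : R, (1 + 2 * s) ^+ 7 = 1 + 2 * s + 4 * A.
Proof.
exists (3 * s + 21 * s ^+ 2 + 70 * s ^+ 3 + 140 * s ^+ 4 + 168 * s ^+ 5
  + 112 * s ^+ 6 + 32 * s ^+ 7); ring.
Qed.

Lemma one_add2_exp5 s : exists A : R, (1 + 2 * s) ^+ 5 = 1 + 2 * A.
Proof.
exists (5 * s + 20 * s ^+ 2 + 40 * s ^+ 3 + 40 * s ^+ 4 + 16 * s ^+ 5); ring.
Qed.

Lemma one_add2_exp8D1 (g : R) m :
  exists h, (1 + 2 * g) ^+ (8 * m + 1) = 1 + 2 * g + 16 * h.
Proof.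
have [A hA] := one_add2_exp8 g; rewrite addn1 exprS exprM hA.
have [B ->] : exists B : R, (1 + 16 * A) ^+ m = 1 + 16 * B.
  elim: m => [|m [B IH]]; first by exists 0; rewrite mulr0 addr0.
  by exists (A + B + 16 * A * B); rewrite exprS IH; ring.
by exists ((1 + 2 * g) * B); ring.
Qed.

(** When a and a' have exponents 0 modulo 3, U has 1 and U' has 2, this collects the terms of the
    expansion with exponents 1 modulo 3; [theta_part2] collects those with 2. *)
Definition theta_part1 a a' U U' : R :=
  a ^+ 3 * a' ^+ 7 * (2 * a ^+ 4 * a' * U - 8 * a ^+ 3 * U ^+ 2 * U').

Definition theta_part2 a a' U U' : R :=
  a ^+ 3 * a' ^+ 7 * (4 * a ^+ 3 * a' * U ^+ 2 - 2 * a ^+ 5 * U').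

Lemma theta_quotient_mod16 G a a' s s' U U' W :
  a = 1 + 2 * s -> a' = 1 + 2 * s' -> U ^+ 2 = U' + 2 * W ->
  G * (a - 2 * U) * a' = (a' - 2 * U') * a ->
  exists h, G = 1 + 4 * (U * U') - 8 * (U * U' * (s + s'))
    + theta_part1 a a' U U' + theta_part2 a a' U U' + 16 * h.
Proof.
move=> as1 as1' UU E.
have [A a8] : exists A : R, a ^+ 8 = 1 + 16 * A by rewrite as1; exact: one_add2_exp8.
have [A' a8'] : exists A : R, a' ^+ 8 = 1 + 16 * A by rewrite as1'; exact: one_add2_exp8.
have [B a7] : exists A : R, a ^+ 7 = 1 + 2 * s + 4 * A by rewrite as1; exact: one_add2_exp7.
have [B' a7'] : exists A : R, a' ^+ 7 = 1 + 2 * s' + 4 * A.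
  by rewrite as1'; exact: one_add2_exp7.
have [C a5] : exists A : R, a ^+ 5 = 1 + 2 * A by rewrite as1; exact: one_add2_exp5.
clear as1 as1'.
(* The inverse of a - 2 U is (a^2 + 2 a U + 4 U^2) / (a^3 - 8 U^3), and
   (a^3 - 8 U^3) (a^3 + 8 U^3) = a^6 modulo 16. *)
pose K := (a ^+ 2 + 2 * a * U + 4 * U ^+ 2) * (a ^+ 3 + 8 * U ^+ 3) * a ^+ 2 * a' ^+ 7.
have EK : G * (a - 2 * U) * a' * K = (a' - 2 * U') * a * K by rewrite E.
have {EK E} [h1 G1] : exists h : R, G * (a ^+ 8 * a' ^+ 8) =
    a ^+ 8 * a' ^+ 8 + 8 * a ^+ 5 * U ^+ 3 * a' ^+ 8 - 4 * (a ^+ 7 * a' ^+ 7 * (U * U'))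
    + theta_part1 a a' U U' + theta_part2 a a' U U' + 16 * h.
  exists (a ^+ 3 * a' ^+ 7 * (a' - 2 * U') * (a * U ^+ 4 + 2 * U ^+ 5)
    + 4 * G * a ^+ 2 * a' ^+ 8 * U ^+ 6 - a ^+ 5 * a' ^+ 7 * U' * U ^+ 3).
  transitivity ((a' - 2 * U') * a * K + 64 * G * a ^+ 2 * a' ^+ 8 * U ^+ 6).
    by rewrite -EK /K; ring.
  by rewrite /K /theta_part1 /theta_part2; ring.
(* The factor a^8 a'^8 is 1 modulo 16. *)
have [h2 G2] : exists h : R, G = G * (a ^+ 8 * a' ^+ 8) + 16 * h.
  by exists (- G * (A + A' + 16 * A * A')); rewrite a8 a8'; ring.
rewrite {1}G2 G1.
set X1 := theta_part1 _ _ _ _; set X2 := theta_part2 _ _ _ _.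
(* Modulo 16, 8 U^3 is 8 UU' and 4 a^7 a'^7 is 4 + 8 (s + s'); the difference 8 UU' - 4 UU' leaves
   the term 4 UU'. *)
rewrite (_ : U ^+ 3 = U * U ^+ 2); last by rewrite exprS.
rewrite UU a8 a8' a7 a7' a5.
exists (A + A' + 16 * A * A' + U * W * (1 + 2 * C) * (1 + 16 * A')
  + U * U' * (8 * A' + C * (1 + 16 * A')) 
  - U * U' * (s * s' + B * (1 + 2 * s' + 4 * B') + B' * (1 + 2 * s)) + h1 + h2).
ring.
Qed.

End ModSixteen.

(* For c prime to 3; the terms with 3 | c of gauss_theta d make up
   gauss_theta (9 * d). *)
Definition alt_sign3 c : int := if (3 %| c)%N then 0 else (- 1) ^+ c.+1.

Lemma gauss_theta_split3 d : (0 < d)%N ->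
  gauss_theta d = gauss_theta (9 * d) - 2 * square_series alt_sign3 d.
Proof.
move=> d0; rewrite /gauss_theta.
suff -> : square_series alt_sign d =
  square_series alt_sign (9 * d) - square_series alt_sign3 d by ring.
apply/fpsP => k; rewrite coef_fpsD coef_fpsN /= /alt_sign.
have -> : \sum_(1 <= c < k.+1 | (9 * d * c ^ 2)%N == k) (- 1 : int) ^+ c =
    \sum_(1 <= c < k.+1 | ((d * c ^ 2)%N == k) && (3 %| c)%N) (- 1 : int) ^+ c.
  have P : perm_eq [seq c <- index_iota 1 k.+1 | ((d * c ^ 2)%N == k) && (3 %| c)%N]
      [seq (3 * c)%N | c <- index_iota 1 k.+1 & (9 * d * c ^ 2)%N == k].
    apply: uniq_perm; rewrite ?filter_uniq ?iota_uniq //.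
      by rewrite map_inj_uniq ?filter_uniq ?iota_uniq // => x y; lia.
    move=> c; rewrite mem_filter mem_index_iota; apply/idP/mapP.
      case/andP=> /andP[/eqP dck /dvdnP[e ce]] /andP[c0 ck]; exists e; last by lia.
      by rewrite mem_filter mem_index_iota; subst c; nia.
    case=> e; rewrite mem_filter mem_index_iota => /andP[/eqP eq_k /andP[e0 ek]] ->.
    by rewrite dvdn_mulr // andbT; nia.
  rewrite -big_filter -[RHS]big_filter (perm_big _ P) big_map.
  (* The sign is kept because 3c and c have the same parity. *)
  by apply: eq_bigr => c _; rewrite -signr_odd -[RHS]signr_odd oddM.
rewrite (bigID (fun c => (3 %| c)%N)) /=; congr (_ + _).
rewrite [in RHS](bigID (fun c => (3 %| c)%N)) /= [X in - (X + _)]big1 ?add0r.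
  rewrite -sumrN; apply: eq_bigr => c /andP[_ /negPf c3].
  by rewrite /alt_sign3 c3 exprS mulN1r opprK.
by move=> c /andP[_ c3]; rewrite /alt_sign3 c3.
Qed.

Lemma sqr_sum_mod2 (R : comPzRingType) (I : Type) (r : seq I) (F : I -> R) :
  exists W, (\sum_(i <- r) F i) ^+ 2 = \sum_(i <- r) F i ^+ 2 + 2 * W.
Proof.
elim: r => [|i r [W IH]]; first by exists 0; rewrite !big_nil; ring.
by exists (W + F i * \sum_(j <- r) F j); rewrite !big_cons sqrrD IH; ring.
Qed.

Lemma alt_sign3_sqr c : exists v, alt_sign3 c ^+ 2 = alt_sign3 c + 2 * v.
Proof.
rewrite /alt_sign3; case: ifP => _; first by exists 0.
rewrite -signr_odd; case: (odd _); last by exists 0.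
by exists 1.
Qed.

(** Frobenius modulo 2: cross terms occur twice, q^(c^2) squares to q^(2 c^2), and the coefficients
    0, 1, -1 have the parity of their squares. *)
Lemma square_series_sqr :
  exists W, square_series alt_sign3 1 ^+ 2 = square_series alt_sign3 2 + 2 * W.
Proof.
set f := _ ^+ 2; set g := square_series _ 2.
have even_diff n : exists w : int, f n = g n + 2 * w.
  pose fn : fps int := \sum_(1 <= c < n.+1) (alt_sign3 c)%:~R * 'q ^+ (1 * c ^ 2).
  have -> : f n = (fn ^+ 2) n.
    by rewrite /f !expr2; apply: (@fps_eqnM _ n) => //; exact: square_series_trunc.
  have [W ->] := sqr_sum_mod2 (index_iota 1 n.+1)
    (fun c => (alt_sign3 c)%:~R * 'q ^+ (1 * c ^ 2) : fps int).
  rewrite (@square_series_trunc alt_sign3 2 n isT n (leqnn n)).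
  have [V ->] : exists V : fps int, \sum_(1 <= c < n.+1)
      ((alt_sign3 c)%:~R * 'q ^+ (1 * c ^ 2)) ^+ 2 =
    \sum_(1 <= c < n.+1) (alt_sign3 c)%:~R * 'q ^+ (2 * c ^ 2) + 2 * V.
    elim: (index_iota 1 n.+1) => [|c r [V IH]].
      by exists 0; rewrite !big_nil mulr0 addr0.
    have [v hv] := alt_sign3_sqr c.
    exists (V + v%:~R * 'q ^+ (2 * c ^ 2)).
    rewrite !big_cons IH exprMn -rmorphXn hv rmorphD rmorphM /= -exprM.
    rewrite (_ : (1 * c ^ 2 * 2 = 2 * c ^ 2)%N); last by lia.
    ring.
  exists (V n + W n); rewrite !coef_fpsD -addrA; congr (_ + _).
  by rewrite !mulr_natl !coef_fpsMn mulrnDl.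
(* Evenness is known one coefficient at a time, so W is obtained by halving each coefficient. *)
pose W : fps int := Fps (fun n => ((f n - g n) %/ 2)%Z).
exists W; apply/fpsP => n; have [w fw] := even_diff n.
have Wn : W n = w.
  by transitivity ((f n - g n) %/ 2)%Z; rewrite // fw addrAC subrr add0r mulrC mulzK.
by rewrite coef_fpsD mulr_natl coef_fpsMn Wn -mulr_natl.
Qed.

(** * Coefficients at exponents divisible by 3 *)

Section SupportModThree.
Variable R : comNzRingType.
Implicit Types f g : fps R.

Definition supp3 r f := forall n, (n != r %[mod 3])%N -> f n = 0.

Lemma coef_fps_natM k f n : (k%:R * f) n = k%:R * f n.
Proof. by rewrite !mulr_natl coef_fpsMn. Qed.

Lemma supp3D r f g : supp3 r f -> supp3 r g -> supp3 r (f + g).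
Proof. by move=> f0 g0 n nr; rewrite coef_fpsD f0 // g0 // addr0. Qed.

Lemma supp3N r f : supp3 r f -> supp3 r (- f).
Proof. by move=> f0 n nr; rewrite coef_fpsN f0 // oppr0. Qed.

Lemma supp3M r s f g : supp3 r f -> supp3 s g -> supp3 (r + s) (f * g).
Proof.
move=> f0 g0 n nrs; rewrite coef_fpsM big1 // => i _.
have [ir|ir] := eqVneq (i %% 3)%N (r %% 3)%N; last by rewrite f0 // mul0r.
rewrite (g0 (n - i)%N) ?mulr0 //; apply: contraNN nrs => /eqP ni.
have le_in : (i <= n)%N by rewrite -ltnS.
by rewrite -[X in (X %% 3)%N](subnKC le_in) -modnDm ir ni modnDm.
Qed.

Lemma supp3_1 : supp3 0 1.
Proof. by move=> n n0; rewrite coef_fps1; case: n n0. Qed.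

Lemma supp3_nat k : supp3 0 k%:R.
Proof.
by elim: k => // k IH; rewrite -addn1 natrD; apply: supp3D => //; exact: supp3_1.
Qed.

Lemma supp3_0X f k : supp3 0 f -> supp3 0 (f ^+ k).
Proof.
move=> f0; elim: k => [|k IH]; first by rewrite expr0; exact: supp3_1.
by rewrite exprS; exact: (supp3M f0 IH).
Qed.

End SupportModThree.

Lemma supp3_square_series3 w d : (3 %| d)%N -> supp3 0 (square_series w d).
Proof.
move=> d3 n n0 /=; rewrite big1 // => c /eqP dcn; case/negP: n0.
by rewrite -dcn eqn_mod_dvd // subn0 dvdn_mulr.
Qed.

Lemma sqrn_mod3 c : (c ^ 2 %% 3 = ~~ (3 %| c))%N.
Proof.
rewrite -modnXm /dvdn; have := ltn_pmod c (isT : 0 < 3)%N.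
by case: (c %% 3)%N => [|[|[|]]].
Qed.

Lemma supp3_alt_sign3 d : supp3 d (square_series alt_sign3 d).
Proof.
move=> n nd /=; rewrite big1 // => c /eqP dcn; rewrite /alt_sign3.
case: ifPn => // c3; case/negP: nd.
by rewrite -dcn -modnMmr sqrn_mod3 c3 muln1.
Qed.

Lemma supp3_gauss_theta d : (3 %| d)%N -> supp3 0 (gauss_theta d).
Proof.
move=> d3; apply: supp3D; first exact: supp3_1.
by apply: (@supp3M _ 0 0); [exact: supp3_nat | exact: supp3_square_series3].
Qed.

(** The parts [theta_part1] and [theta_part2] have no exponents in 3Z, and n > 0 discards the
    constant term 1. *)
Lemma schur9_gen_coef3 n : (0 < n)%N ->
  exists h : int, schur9_gen 1 (3 * n) =
    4 * (square_series alt_sign3 1 * square_series alt_sign3 2) (3 * n)%N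
    - 8 * (square_series alt_sign3 1 * square_series alt_sign3 2
      * (square_series alt_sign 9 + square_series alt_sign 18)) (3 * n)%N
    + 16 * h.
Proof.
move=> n0; set U := square_series alt_sign3 1; set U' := square_series alt_sign3 2.
have [W UU] := square_series_sqr.
have := schur9_gen_theta.
rewrite (@gauss_theta_split3 1) // (@gauss_theta_split3 2) // -/U -/U' !muln1.
rewrite (_ : (9 * 2 = 18)%N) // => E.
have [h ->] := theta_quotient_mod16 (erefl : gauss_theta 9 = 1 + 2 * _)
  (erefl : gauss_theta 18 = 1 + 2 * _) UU E.
have A0 k : supp3 0 (gauss_theta 9 ^+ k).
  by apply: supp3_0X; exact: supp3_gauss_theta.
have A0' k : supp3 0 (gauss_theta 18 ^+ k).
  by apply: supp3_0X; exact: supp3_gauss_theta.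
have A1' : supp3 0 (gauss_theta 18) by exact: supp3_gauss_theta.
have U1 : supp3 1 U by exact: supp3_alt_sign3.
have U2 : supp3 2 U' by exact: supp3_alt_sign3.
have X1 : supp3 1 (theta_part1 (gauss_theta 9) (gauss_theta 18) U U').
  apply: (@supp3M _ 0 1); first exact: (@supp3M _ 0 0).
  apply: supp3D.
    apply: (@supp3M _ 0 1) => //; apply: (@supp3M _ 0 0) => //.
    by apply: (@supp3M _ 0 0) => //; exact: supp3_nat.
  apply: supp3N => k k1; apply: (_ : supp3 4 _); last by rewrite (_ : 4 %% 3 = 1 %% 3)%N.
  apply: (@supp3M _ 2 2) => //; apply: (@supp3M _ 0 2); last exact: (@supp3M _ 1 1).
  by apply: (@supp3M _ 0 0) => //; exact: supp3_nat.
have X2 : supp3 2 (theta_part2 (gauss_theta 9) (gauss_theta 18) U U').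
  apply: (@supp3M _ 0 2); first exact: (@supp3M _ 0 0).
  apply: supp3D.
    apply: (@supp3M _ 0 2); last exact: (@supp3M _ 1 1).
    apply: (@supp3M _ 0 0) => //.
    by apply: (@supp3M _ 0 0) => //; exact: supp3_nat.
  apply: supp3N; apply: (@supp3M _ 0 2) => //.
  by apply: (@supp3M _ 0 0) => //; exact: supp3_nat.
exists (h (3 * n)%N).
rewrite !coef_fpsD X1 ?X2; [|by rewrite modnMr..].
have -> : (1 : fps int) (3 * n)%N = 0.
  by rewrite coef_fps1 (_ : (3 * n == 0)%N = false) //; lia.
rewrite !addr0 coef_fpsN add0r.
by rewrite !coef_fps_natM.
Qed.

Lemma schur9_gen_mod2 : exists g : fps int, schur9_gen 1 = 1 + 2 * g.
Proof.
have [W UU] := square_series_sqr; have := schur9_gen_theta.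
rewrite (@gauss_theta_split3 1) // (@gauss_theta_split3 2) // !muln1 => E.
have [h ->] := theta_quotient_mod16 (erefl : gauss_theta 9 = 1 + 2 * _)
  (erefl : gauss_theta 18 = 1 + 2 * _) UU E.
rewrite /theta_part1 /theta_part2.
move: (gauss_theta 9) (gauss_theta 18) (square_series _ 1) (square_series _ 2)
  (square_series _ 9) (square_series _ 18) => a a' U U' s s'.
exists (2 * (U * U') - 4 * (U * U' * (s + s'))
  + a ^+ 3 * a' ^+ 7 * (a ^+ 4 * a' * U - 4 * a ^+ 3 * U ^+ 2 * U')
  + a ^+ 3 * a' ^+ 7 * (2 * a ^+ 3 * a' * U ^+ 2 - a ^+ 5 * U') + 8 * h).
ring.
Qed.

(** * Coefficients as sums over representations by x^2 + D y^2 *)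

Definition reps D n : seq (nat * nat) :=
  [seq z <- [seq (x, y) | x <- iota 1 n, y <- iota 1 n] |
    (z.1 ^ 2 + D * z.2 ^ 2 == n)%N].

Lemma mem_reps D n x y : (0 < D)%N ->
  ((x, y) \in reps D n) = [&& (0 < x)%N, (0 < y)%N & (x ^ 2 + D * y ^ 2 == n)%N].
Proof.
move=> D0; rewrite mem_filter /= andbC andbA; have [xyn|] := eqVneq; last first.
  by rewrite !andbF.
rewrite !andbT; apply/allpairsP/andP => [[z [] + + [-> ->]]|[x0 y0]].
  by rewrite !mem_iota => /andP[-> _] /andP[-> _].
by exists (x, y); rewrite !mem_iota /=; split=> //; nia.
Qed.

Lemma reps_uniq D n : uniq (reps D n).
Proof.
by rewrite filter_uniq // allpairs_uniq ?iota_uniq // => -[? ?] [? ?].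
Qed.

Lemma coef_mul_square_series (f : fps int) w d n : (0 < d)%N ->
  (f * square_series w d) n =
  \sum_(1 <= c < n.+1 | (d * c ^ 2 <= n)%N) f (n - d * c ^ 2)%N * w c.
Proof.
move=> d0; rewrite (fps_eqnM (@fps_eqn_refl _ n f) (@square_series_trunc w d n d0)) //.
rewrite mulr_sumr coef_fps_sum [RHS]big_mkcond; apply: eq_bigr => c _.
rewrite mulrCA coef_fps_intrM intz mulrC; set k := (d * c ^ 2)%N.
rewrite coef_fpsM; case: (leqP k n) => [kn|nk].
  rewrite (bigD1 (Ordinal (leq_subr k n : (n - k < n.+1)%N))) //=.
  rewrite subKn // coef_fpsXn eqxx mulr1 big1 ?addr0 // => i /negP ik.
  rewrite coef_fpsXn; case: eqP => [nik|]; last by rewrite mulr0.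
  by case: ik; apply/eqP/val_inj => /=; have := ltn_ord i; lia.
rewrite big1 ?mul0r // => i _; rewrite coef_fpsXn ltn_eqF ?mulr0 //.
by rewrite (leq_ltn_trans (leq_subr _ _)).
Qed.

Lemma coef_square_seriesM w w' d n : (0 < d)%N ->
  (square_series w 1 * square_series w' d) n =
  \sum_(z <- reps d n) w z.1 * w' z.2.
Proof.
move=> d0; rewrite coef_mul_square_series // big_filter [LHS]big_mkcond [RHS]big_mkcond /=.
have iotaE : iota 1 n = index_iota 1 n.+1 by rewrite /index_iota subn1.
rewrite iotaE big_allpairs exchange_big.
apply: eq_big_nat => y /andP[y0 yn] /=.
case: leqP => [dyn|ndy]; last first.
  by rewrite big1 // => x _; case: eqP => //; lia.
rewrite mulr_suml [RHS](@big_cat_nat _ _ _ (n - d * y ^ 2).+1) //=; last by lia.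
rewrite [X in _ + X]big_nat_cond [X in _ + X]big1 ?addr0; last first.
  by move=> x /andP[/andP[xn _] _]; case: eqP => //; nia.
rewrite big_mkcond; apply: eq_bigr => x _; rewrite mul1n.
by congr (if _ then _ else _); apply/eqP/eqP; lia.
Qed.

(** * Representations of 3m by x^2 + 2y^2 *)

Definition sqrts m := [seq x <- iota 1 m | (x ^ 2 == m)%N].

Lemma mem_sqrts m x : (x \in sqrts m) = (0 < x)%N && (x ^ 2 == m)%N.
Proof.
rewrite mem_filter mem_iota andbC; have [xm|] := eqVneq; last by rewrite !andbF.
by rewrite !andbT; case: ltnP => //= x0; nia.
Qed.

Lemma reps2_mod3 m x y : (m %% 3 = 1)%N -> (x ^ 2 + 2 * y ^ 2)%N = m ->
  ~~ (3 %| x)%N && (3 %| y)%N.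
Proof.
move=> m1 xym; move: m1; rewrite -xym -modnDm -[in X in (_ + X)%N]modnMmr !sqrn_mod3.
by case: (3 %| x)%N; case: (3 %| y)%N.
Qed.

(** Modulo 3 the form is c^2 - d^2, so 3 divides both or neither; dividing both would give 9 |
    3m. *)
Lemma reps2_mod9 m c d : (m %% 3 = 1)%N -> (c ^ 2 + 2 * d ^ 2)%N = (3 * m)%N ->
  ~~ (3 %| c)%N && ~~ (3 %| d)%N.
Proof.
move=> m1 cdm; have : ((c ^ 2 + 2 * d ^ 2) %% 3 = 0)%N by rewrite cdm modnMr.
rewrite -modnDm -[in X in (_ + X)%N]modnMmr !sqrn_mod3.
case: (boolP (3 %| c)%N) => [/dvdnP[c' cc]|]; case: (boolP (3 %| d)%N) => [/dvdnP[d' dd]|] //=.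
by move: cdm; rewrite cc dd -!mulnn; nia.
Qed.

(* Up to signs, the products of x + y sqrt(-2) with 1 - sqrt(-2) and 1 + sqrt(-2). *)
Definition mul3_plus (z : nat * nat) := (z.1 + 2 * z.2, (z.1 - z.2) + (z.2 - z.1))%N.
Definition mul3_minus (z : nat * nat) :=
  ((z.1 - 2 * z.2) + (2 * z.2 - z.1), z.1 + z.2)%N.

(** Since 3 = (1 + sqrt(-2))(1 - sqrt(-2)), one of these factors divides c + d sqrt(-2), and the
    quotient has norm m. The pairs (c, c) come from quotients with y = 0, that is, from m = c^2. *)
Lemma perm_reps2_mul3 m : (m %% 3 = 1)%N ->
  perm_eq (reps 2 (3 * m))
    (map mul3_plus (reps 2 m) ++ map mul3_minus (reps 2 m)
      ++ map (fun c => (c, c)) (sqrts m)).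
Proof.
move=> m1; apply: uniq_perm; first exact: reps_uniq.
  (* Injectivity and disjointness: 3 divides y but not x, so reduction modulo 3 and positivity
     settle the signs lost in the absolute values. *)
  have uniqR := reps_uniq 2 m.
  rewrite !cat_uniq !map_inj_in_uniq ?uniqR ?[uniq (sqrts m)]filter_uniq ?iota_uniq //=; first last.
  - move=> [x y] [x' y']; rewrite !mem_reps // => /and3P[x0 y0 /eqP E] /and3P[x0' y0' /eqP E'].
    have /andP[/negP nx /dvdnP[k yk]] := reps2_mod3 m1 E.
    have /andP[/negP nx' /dvdnP[k' yk']] := reps2_mod3 m1 E'.
    rewrite /mul3_plus /= => -[e1 e2]; subst y y'.
    by congr pair; lia.
  - move=> [x y] [x' y']; rewrite !mem_reps // => /and3P[x0 y0 /eqP E] /and3P[x0' y0' /eqP E'].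
    have /andP[/negP nx /dvdnP[k yk]] := reps2_mod3 m1 E.
    have /andP[/negP nx' /dvdnP[k' yk']] := reps2_mod3 m1 E'.
    rewrite /mul3_minus /= => -[e1 e2]; subst y y'.
    by congr pair; lia.
  - by move=> ? ? _ _ [].
  rewrite !andbT has_cat negb_or -andbA; apply/and3P; split.
  - apply/hasP => -[w /mapP[[x y] + ->] /mapP[[x' y']]].
    rewrite !mem_reps // => /and3P[x0 y0 /eqP E] /and3P[x0' y0' /eqP E'].
    have /andP[/negP nx /dvdnP[k yk]] := reps2_mod3 m1 E.
    have /andP[/negP nx' /dvdnP[k' yk']] := reps2_mod3 m1 E'.
    rewrite /mul3_minus /mul3_plus /= => -[e1 e2]; subst y y'; lia.
  - apply/hasP => -[w /mapP[c + ->] /mapP[[x y]]].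
    rewrite mem_reps // mem_sqrts => /andP[c0 /eqP cm] /and3P[x0 y0 /eqP E].
    have /andP[/negP nx /dvdnP[k yk]] := reps2_mod3 m1 E.
    rewrite /mul3_plus /= => -[e1 e2]; subst y; lia.
  - apply/hasP => -[w /mapP[c + ->] /mapP[[x y]]].
    rewrite mem_reps // mem_sqrts => /andP[c0 /eqP cm] /and3P[x0 y0 /eqP E].
    have /andP[/negP nx /dvdnP[k yk]] := reps2_mod3 m1 E.
    rewrite /mul3_minus /= => -[e1 e2]; subst y; lia.
move=> [c d]; rewrite mem_reps // !mem_cat; apply/idP/idP.
  case/and3P => c0 d0 /eqP cdm; have /andP[nc nd] := reps2_mod9 m1 cdm.
  have mem2 x y : (0 < x)%N -> (0 < y)%N -> (x ^ 2 + 2 * y ^ 2)%N = m -> (x, y) \in reps 2 m.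
    by move=> x0 y0 /eqP xym; rewrite mem_reps // x0 y0.
  (* The congruence selects the factor of 3 that divides c + d sqrt(-2); the comparisons decide the
     signs of the quotient. *)
  have : ((c %% 3 = d %% 3) \/ ((c + d) %% 3 = 0))%N by lia.
  case=> cd3; [case: (ltngtP c d) => cd|case: (ltngtP c (2 * d)) => cd].
  - apply/orP; right; apply/orP; left; apply/mapP.
    have [y dy] : exists y, d = (c + 3 * y)%N by exists ((d - c) %/ 3)%N; lia.
    exists (c + 2 * y, y)%N; last by rewrite /mul3_minus /=; congr pair; lia.
    by apply: mem2; [lia..|move: cdm; rewrite dy -!mulnn; lia].
  - apply/orP; left; apply/mapP.
    have [y dy] : exists y, c = (d + 3 * y)%N by exists ((c - d) %/ 3)%N; lia.
    exists (d + y, y)%N; last by rewrite /mul3_plus /=; congr pair; lia.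
    by apply: mem2; [lia..|move: cdm; rewrite dy -!mulnn; lia].
  - do 2![apply/orP; right]; apply/mapP; exists c; last by rewrite cd.
    by rewrite mem_sqrts c0 /=; apply/eqP; move: cdm; rewrite -cd -!mulnn; lia.
  - apply/orP; right; apply/orP; left; apply/mapP.
    have [x dx] : exists x, (2 * d = c + 3 * x)%N by exists ((2 * d - c) %/ 3)%N; lia.
    exists (x, (d - x))%N; last by rewrite /mul3_minus /=; congr pair; lia.
    have [y dy] : exists y, d = (x + y)%N by exists (d - x)%N; lia.
    have cy : c = (2 * y - x)%N by lia.
    by rewrite dy addKn; apply: mem2; [lia..|move: cdm; rewrite -!mulnn; nia].
  - apply/orP; left; apply/mapP.
    have [x dx] : exists x, (c = 2 * d + 3 * x)%N by exists ((c - 2 * d) %/ 3)%N; lia.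
    exists (x, (d + x))%N; last by rewrite /mul3_plus /=; congr pair; lia.
    by apply: mem2; [lia..|move: cdm; rewrite dx -!mulnn; lia].
  (* Here c = 2d gives m = 2 d^2, which is 2 modulo 3. *)
  - by have := sqrn_mod3 d; move: cdm; rewrite nd cd -!mulnn; lia.
move=> /or3P[] /mapP[].
- move=> [x y]; rewrite mem_reps // => /and3P[x0 y0 /eqP E] [-> ->].
  have /andP[/negP nx /dvdnP[k yk]] := reps2_mod3 m1 E.
  rewrite /=; apply/and3P; split; [lia..|apply/eqP; subst y].
  case: (leqP x (k * 3)) => [xk|xk].
    by rewrite (eqP xk) add0n; have [t kt] : exists t, (k * 3 = x + t)%N;
      [exists (k * 3 - x)%N; lia | move: E; rewrite kt addKn -!mulnn; lia].
  have [t kt] : exists t, (x = k * 3 + t)%N by exists (x - k * 3)%N; lia.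
  rewrite (_ : x - k * 3 + (k * 3 - x) = t)%N; last by lia.
  by move: E; rewrite kt -!mulnn; lia.
- move=> [x y]; rewrite mem_reps // => /and3P[x0 y0 /eqP E] [-> ->].
  have /andP[/negP nx /dvdnP[k yk]] := reps2_mod3 m1 E.
  rewrite /=; apply/and3P; split; [lia..|apply/eqP].
  case: (leqP x (2 * y)) => [xk|xk].
    have [t kt] : exists t, (2 * y = x + t)%N by exists (2 * y - x)%N; lia.
    rewrite (_ : x - 2 * y + (2 * y - x) = t)%N; last by lia.
    by move: E; rewrite -!mulnn; nia.
  have [t kt] : exists t, (x = 2 * y + t)%N by exists (x - 2 * y)%N; lia.
  rewrite (_ : x - 2 * y + (2 * y - x) = t)%N; last by lia.
  by move: E; rewrite kt -!mulnn; lia.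
- move=> x; rewrite mem_sqrts => /andP[x0 /eqP xm] [-> ->].
  by apply/and3P; split=> //; apply/eqP; lia.
Qed.

Lemma size_reps2_mul3 m : (m %% 3 = 1)%N ->
  size (reps 2 (3 * m)) = (2 * size (reps 2 m) + size (sqrts m))%N.
Proof.
by move=> /perm_reps2_mul3 /perm_size ->; rewrite !size_cat !size_map; lia.
Qed.

(** * From coefficients to the parity of representation numbers *)

Notation ones := (square_series (fun=> 1)).

Lemma size_sqrts m : ones 1 m = (size (sqrts m))%:R.
Proof.
rewrite /= /sqrts -sum1_size natr_sum big_filter.
by apply: congr_big => //; [rewrite /index_iota subn1|move=> x; rewrite mul1n].
Qed.

Lemma size_reps D n : (0 < D)%N -> (ones 1 * ones D) n = (size (reps D n))%:R.
Proof.
move=> D0; rewrite coef_square_seriesM // -sum1_size natr_sum.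
by apply: eq_bigr => z _; rewrite mulr1.
Qed.

Lemma coef_alt_sign3M n : (square_series alt_sign3 1 * square_series alt_sign3 2) n =
  \sum_(z <- reps 2 n) alt_sign3 z.1 * alt_sign3 z.2.
Proof. exact: coef_square_seriesM. Qed.

Lemma signF2 k : ((- 1) ^+ k : 'F_2) = 1.
Proof. by rewrite (_ : -1 = 1 :> 'F_2) ?expr1n //; apply/val_inj. Qed.

(** Modulo 2 the signs disappear and the representations of 3m are counted; by [size_reps2_mul3]
    only a square root of m survives. *)
Lemma coef_alt_sign3_mul3_parity m : (m %% 3 = 1)%N ->
  ((square_series alt_sign3 1 * square_series alt_sign3 2) (3 * m)%N)%:~R
  = (ones 1 m)%:~R :> 'F_2.
Proof.
move=> m1; rewrite coef_alt_sign3M size_sqrts rmorph_sum /= mulrz_nat.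
have -> : (size (sqrts m))%:R = (size (reps 2 (3 * m)))%:R :> 'F_2.
  rewrite size_reps2_mul3 // natrD natrM (_ : 2%:R = 0 :> 'F_2) ?mul0r ?add0r //.
  exact/val_inj.
rewrite -sum1_size natr_sum; apply: eq_big_seq => -[c d].
rewrite mem_reps // => /and3P[_ _ /eqP cd]; have /andP[/negPf c3 /negPf d3] := reps2_mod9 m1 cd.
by rewrite /alt_sign3 /= c3 d3 rmorphM !rmorphXn /= rmorphN1 !signF2 mulr1.
Qed.

Lemma even_mul_succ k : exists j, (k * (k + 1) = 2 * j)%N.
Proof.
exists (k * (k + 1))./2; rewrite mul2n even_halfK //.
by rewrite oddM oddD /= addbT; case: (odd k).
Qed.

(** All terms have the same sign: c is odd, so 3m = 1 + 2 d^2 modulo 8, and 3m modulo 8 determines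
    the parity of d. *)
Lemma coef_alt_sign3_mul3_sign m : odd m -> (m %% 3 = 1)%N ->
  exists e : int, (square_series alt_sign3 1 * square_series alt_sign3 2) (3 * m)%N
    = e * (size (reps 2 (3 * m)))%:R.
Proof.
move=> modd m1; exists ((- 1) ^+ ((3 * m) %% 8 == 1)%N).
rewrite coef_alt_sign3M -sum1_size natr_sum mulr_sumr; apply: eq_big_seq => -[c d].
rewrite mem_reps // => /and3P[_ _ /eqP cd]; have /andP[/negPf c3 /negPf d3] := reps2_mod9 m1 cd.
rewrite /alt_sign3 /= c3 d3 mulr1 -signr_odd -[_ ^+ d.+1]signr_odd /=.
have codd : odd c by have := congr1 odd cd; rewrite -mulnn oddD !oddM modd andbb /= addbF.
rewrite codd expr0 mul1r; congr (_ ^+ nat_of_bool _); rewrite -cd.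
have [k ->] : exists k, c = (2 * k + 1)%N by exists c./2; lia.
case: (boolP (odd d)) => dodd.
  have [l ->] : exists l, d = (2 * l + 1)%N by exists d./2; lia.
  have [k' kk] := even_mul_succ k.
  have [l' ll] := even_mul_succ l.
  by apply/esym/negbTE/eqP; rewrite -!mulnn; lia.
have [l ->] : exists l, d = (2 * l)%N by exists d./2; lia.
have [k' kk] := even_mul_succ k.
rewrite (_ : (_ %% 8 = 1)%N) //.
by rewrite -!mulnn; lia.
Qed.

(** The term at c of the product involves UU' at the exponent 3 (m - 3d c^2), whose coefficient is
    odd exactly when m - 3d c^2 is a positive square. *)
Lemma coef_alt_sign3_ternary_parity d m : (0 < d)%N -> (m %% 3 = 1)%N ->
  ((square_series alt_sign3 1 * square_series alt_sign3 2
    * square_series alt_sign (9 * d)) (3 * m)%N)%:~R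
  = (size (reps (3 * d) m))%:R :> 'F_2.
Proof.
move=> d0 m1; rewrite -mulrz_nat -size_reps ?muln_gt0 //.
rewrite !coef_mul_square_series ?muln_gt0 // !rmorph_sum /=.
rewrite [LHS]big_mkcond [RHS]big_mkcond /=.
rewrite [LHS](@big_cat_nat _ _ _ m.+1) //=; last by lia.
rewrite [X in _ + X]big_nat_cond [X in _ + X]big1 ?addr0; last first.
  by move=> c /andP[/andP[mc _] _]; case: leqP => //; nia.
apply: eq_bigr => c _.
rewrite (_ : (9 * d * c ^ 2 = 3 * (3 * d * c ^ 2))%N) ?leq_pmul2l //; last by lia.
case: leqP => // dcm; rewrite -mulnBr !rmorphM /= coef_alt_sign3_mul3_parity.
  by rewrite /alt_sign rmorphXn /= rmorphN1 signF2.
by move: dcm; rewrite -mulnA; lia.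
Qed.

(** As m is not a square, the coefficient of UU' is, up to sign, twice an even number, so 4 UU'
    contributes a multiple of 16; the coefficients multiplied by 8 are even. *)
Lemma schur9_mod16 k m : odd m -> (m %% 3 = 1)%N -> (forall x, x ^ 2 != m)%N ->
  ~~ odd (size (reps 2 m)) -> ~~ odd (size (reps 3 m)) -> ~~ odd (size (reps 6 m)) ->
  (16 %| schur9 (8 * k + 1) (3 * m))%Z.
Proof.
move=> modd m1 nsq even2 even3 even6.
have m0 : (0 < m)%N by case: m modd {m1 nsq even2 even3 even6}.
have [h1 G1] := schur9_gen_coef3 m0.
set UU := square_series alt_sign3 1 * square_series alt_sign3 2 in G1.
have [e UUm] := coef_alt_sign3_mul3_sign modd m1; rewrite -/UU in UUm.
have sq0 : size (sqrts m) = 0%N.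
  by rewrite /sqrts; apply/eqP; rewrite size_filter -leqn0 leqNgt -has_count;
    apply/hasPn => x _; exact: nsq.
have [r2 R2] : exists r, size (reps 2 m) = (2 * r)%N.
  by exists (size (reps 2 m))./2; rewrite mul2n even_halfK.
have UU4 : UU (3 * m)%N = 4 * (e * r2%:R).
  by rewrite UUm size_reps2_mul3 // sq0 addn0 R2 mulnA natrM; ring.
have parity d : (0 < d)%N -> ~~ odd (size (reps (3 * d) m)) ->
    exists j, (UU * square_series alt_sign (9 * d)) (3 * m)%N = 2 * j.
  move=> d0 ev; have := coef_alt_sign3_ternary_parity d0 m1.
  rewrite -/UU (_ : (size (reps (3 * d) m))%:R = 0 :> 'F_2); last first.
    by rewrite -(even_halfK ev) -mul2n natrM (_ : 2%:R = 0 :> 'F_2) ?mul0r //; exact/val_inj.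
  move=> /eqP; rewrite -(dvdz_pcharf (pchar_Fp (isT : prime 2))).
  by case/dvdzP => j ->; exists j; rewrite mulrC.
have [j1 J1] := parity 1%N isT even3; have [j2 J2] := parity 2%N isT even6.
have [h2 G2] : exists h : int, schur9_gen 1 (3 * m)%N = 16 * h.
  exists (e * r2%:R - j1 - j2 + h1).
  by rewrite G1 UU4 mulrDr coef_fpsD J1 J2; ring.
have [g gE] := schur9_gen_mod2.
have [h3 G3] := one_add2_exp8D1 g k.
rewrite /schur9 schur9_gen_exp gE G3 -gE coef_fpsD coef_fps_natM G2 -mulrDr.
exact: dvdz_mulr.
Qed.

(** * Parity by pairing, and coprime factors of squares *)

(** Remove an element together with its unique partner and induct. A relation is used because the
    partners are only shown to exist. *)
Lemma even_size_pairing (T : eqType) (r : rel T) (s : seq T) : uniq s ->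
  {in s & s, symmetric r} -> {in s, forall x, ~~ r x x} ->
  {in s, forall x, exists2 y, y \in s & r x y} ->
  {in s & &, forall x y z, r x y -> r x z -> y = z} ->
  ~~ odd (size s).
Proof.
have [n] := ubnP (size s); elim: n s => // n IH [|x s] //= sn /andP[xs us] symr irr ex un.
have xin : x \in x :: s by rewrite inE eqxx.
have [y] := ex x xin; rewrite inE => /predU1P[->|ys rxy]; first by rewrite (negPf (irr x xin)).
have yin : y \in x :: s by rewrite inE ys orbT.
have sub z : z \in rem y s -> z \in x :: s.
  by move=> /mem_rem zs; rewrite inE zs orbT.
have sz : size s = (size (rem y s)).+1.
  by rewrite size_rem // prednK //; case: (s) ys.
rewrite sz /= negbK; apply: IH.
- by rewrite -ltnS -sz ltnW // -ltnS -sz.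
- exact: rem_uniq.
- by move=> a b /sub ? /sub ?; exact: symr.
- by move=> a /sub; exact: irr.
- move=> z zs; have zin := sub z zs; have [w win rzw] := ex z zin; exists w => //.
  rewrite mem_rem_uniq // inE; move: win; rewrite inE => /predU1P[wx|ws].
    move: rzw; rewrite wx symr // => rxz; move: zs.
    by rewrite (un x z y) // mem_rem_uniq // inE eqxx.
  rewrite ws andbT; apply/eqP => wy; move: rzw; rewrite wy symr // => ryz.
  have zx : z = x by apply: (un y) => //; rewrite symr.
  by move: xs; rewrite -zx (mem_rem zs).
- by move=> a b c /sub ? /sub ? /sub ?; exact: un.
Qed.

(** The root is r = gcd(Q, g): with Q = q r and g = g' r one has q t = r g'^2, where q is prime to
    g' and r to t, so q and r divide each other. *)
Lemma coprime_mul_sqr Q t g : coprime Q t -> (Q * t = g ^ 2)%N -> exists r, Q = (r ^ 2)%N.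
Proof.
move=> Qt Qtg; have [->|Q0] := posnP Q; first by exists 0%N.
set r := gcdn Q g; have r0 : (0 < r)%N by rewrite gcdn_gt0 Q0.
have /dvdnP[q Qq] : (r %| Q)%N by exact: dvdn_gcdl.
have /dvdnP[g' gg] : (r %| g)%N by exact: dvdn_gcdr.
have qg : coprime q g'.
  by rewrite /coprime -(eqn_pmul2r r0) mul1n muln_gcdl -Qq -gg.
have E : (q * t = r * g' ^ 2)%N.
  by apply/eqP; rewrite -(eqn_pmul2r r0) mulnAC -Qq Qtg gg expnMn; apply/eqP; lia.
exists r; rewrite -mulnn {1}Qq; congr (_ * _)%N; apply/eqP; rewrite eqn_dvd.
apply/andP; split.
  by rewrite -(@Gauss_dvdl q r (g' ^ 2)%N) ?coprimeXr // -E dvdn_mulr.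
have rt : coprime r t by apply: coprime_dvdl Qt; exact: dvdn_gcdl.
by rewrite -(@Gauss_dvdl r q t) // E dvdn_mulr.
Qed.

Lemma sqr_neq_mod3 n x : (n %% 3 = 2)%N -> (x ^ 2 != n)%N.
Proof.
move=> n2; apply/eqP => xn; move: n2; rewrite -xn sqrn_mod3; by case: (3 %| x)%N.
Qed.

(** For g = gcd(x, y), Q divides g^2, and g^2 / Q divides Q', hence is prime to Q. So Q would be a
    square, but it is 2 modulo 3. *)
Lemma dvd_sqrs_absurd D Q Q' x y : coprime Q Q' -> (Q %% 3 = 2)%N ->
  (x ^ 2 + D * y ^ 2 = Q * Q')%N -> (Q %| x ^ 2)%N -> (Q %| y ^ 2)%N -> False.
Proof.
move=> QQ' Qmod3 E Qx Qy.
have Q0 : (0 < Q)%N by case: Q Qmod3 {QQ' E Qx Qy}.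
pose g := gcdn x y.
have [x' xg] : exists k, x = (k * g)%N by apply/dvdnP; exact: dvdn_gcdl.
have [y' yg] : exists k, y = (k * g)%N by apply/dvdnP; exact: dvdn_gcdr.
have [g0|g0] := posnP g.
  have : (Q * Q' = 0)%N by rewrite -E xg yg g0 !muln0.
  move/eqP; rewrite muln_eq0 (gtn_eqF Q0) /= => /eqP Q'0.
  by move: QQ'; rewrite Q'0 /coprime gcdn0 => /eqP QE; move: Qmod3; rewrite QE.
have xy' : coprime x' y'.
  by rewrite /coprime -(eqn_pmul2r g0) mul1n muln_gcdl -xg -yg.
have [t gt] : exists t, (g ^ 2 = t * Q)%N.
  apply/dvdnP; have : (Q %| gcdn (x' ^ 2 * g ^ 2) (y' ^ 2 * g ^ 2))%N.
    by rewrite dvdn_gcd -!expnMn -xg -yg Qx.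
  by rewrite -muln_gcdl (eqP (_ : coprime _ _)) ?mul1n // coprimeXl // coprimeXr.
have tQ' : (t %| Q')%N.
  rewrite -(dvdn_pmul2l Q0) -E xg yg !expnMn mulnC -gt mulnA -mulnDl.
  exact: dvdn_mull.
have [r /esym /eqP] := @coprime_mul_sqr Q t g (coprime_dvdr tQ' QQ') (etrans (mulnC _ _) (esym gt)).
by rewrite (negPf (sqr_neq_mod3 _ Qmod3)).
Qed.

(** * The partner relation and its uniqueness *)

Lemma dvdz_oppr (d n : int) : (d %| - n)%Z = (d %| n)%Z.
Proof. by rewrite !dvdzE abszN. Qed.

(* With alpha = x + y sqrt(-D) and beta = u + v sqrt(-D): Q1 divides
   alpha * conj beta and Q2 divides alpha * beta. For alpha of norm Q1 * Q2
   this says that beta is alpha with its factor of norm Q2 conjugated. *)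
Definition paired (D Q1 Q2 x y u v : int) : bool :=
  [&& (Q1 %| x * u + D * y * v)%Z, (Q1 %| y * u - x * v)%Z,
      (Q2 %| x * u - D * y * v)%Z & (Q2 %| x * v + y * u)%Z].

Lemma paired_sym D Q1 Q2 x y u v : paired D Q1 Q2 x y u v = paired D Q1 Q2 u v x y.
Proof.
rewrite /paired; congr [&& _, _, _ & _].
- by congr (_ %| _)%Z; ring.
- by rewrite -dvdz_oppr; congr (_ %| _)%Z; ring.
- by congr (_ %| _)%Z; ring.
- by congr (_ %| _)%Z; ring.
Qed.

Lemma paired_conj D Q1 Q2 x y u v :
  paired D Q1 Q2 x y u (- v) = paired D Q1 Q2 u v x (- y).
Proof.
rewrite /paired; congr [&& _, _, _ & _].
- by congr (_ %| _)%Z; ring.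
- by congr (_ %| _)%Z; ring.
- by congr (_ %| _)%Z; ring.
- by rewrite -dvdz_oppr; congr (_ %| _)%Z; ring.
Qed.

Lemma pairedN D Q1 Q2 x y u v :
  paired D Q1 Q2 x y (- u) (- v) = paired D Q1 Q2 x y u v.
Proof.
rewrite /paired; congr [&& _, _, _ & _].
all: by rewrite -[in RHS]dvdz_oppr; congr (_ %| _)%Z; ring.
Qed.

Lemma norm_one (D s t : int) : 1 < D -> s ^+ 2 + D * t ^+ 2 = 1 ->
  t = 0 /\ (s = 1 \/ s = - 1).
Proof.
move=> D1 E; have [t0|t0] := eqVneq t 0; last first.
  have t1 : 1 <= t ^+ 2 by clear E D1; nia.
  have s0 : 0 <= s ^+ 2 by clear; nia.
  by exfalso; move: E D1 t1 s0; generalize (s ^+ 2) (t ^+ 2); clear; nia.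
by split=> //; move: E; rewrite t0; clear; nia.
Qed.

(** For partners beta and beta' of alpha, Q1 Q2 divides beta * conj beta', an element of norm (Q1
    Q2)^2; the quotient is a unit, hence 1 or -1. *)
Lemma paired_fun (D Q1 Q2 x y u v u' v' : int) : 1 < D -> 0 < Q1 -> 0 < Q2 ->
  coprimez Q1 Q2 -> x ^+ 2 + D * y ^+ 2 = Q1 * Q2 ->
  u ^+ 2 + D * v ^+ 2 = Q1 * Q2 -> u' ^+ 2 + D * v' ^+ 2 = Q1 * Q2 ->
  paired D Q1 Q2 x y u v -> paired D Q1 Q2 x y u' v' ->
  (u = u' /\ v = v') \/ (u = - u' /\ v = - v').
Proof.
move=> D1 Q1p Q2p cop Nx Nu Nu' /and4P[/dvdzP[a1 A1] /dvdzP[b1 B1] /dvdzP[a2 A2] /dvdzP[b2 B2]].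
move=> /and4P[/dvdzP[a1' A1'] /dvdzP[b1' B1'] /dvdzP[a2' A2'] /dvdzP[b2' B2']].
(* These are the coordinates of beta * conj beta'. The norm of alpha times this is a product of two
   multiples of Q1, and also of two multiples of Q2. *)
pose s := u * u' + D * v * v'; pose t := v * u' - u * v'.
have dvd_cancel (q q' z w : int) : 0 < q -> coprimez q q' -> q * q' * z = q * (q * w) ->
    (q %| z)%Z.
  move=> q0 qq'; rewrite -mulrA => /(mulfI (Num.Theory.lt0r_neq0 q0)) E.
  by rewrite -(@Gauss_dvdzr q q' z) // E dvdz_mulr.
have cop' : coprimez Q2 Q1 by rewrite coprimez_sym.
have s1 : (Q1 %| s)%Z.
  apply: (@dvd_cancel Q1 Q2 s (a1 * a1' + D * b1 * b1')) => //.
  transitivity ((x * u + D * y * v) * (x * u' + D * y * v')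
    + D * (y * u - x * v) * (y * u' - x * v')); first by rewrite -Nx /s; ring.
  by rewrite A1 B1 A1' B1'; ring.
have t1 : (Q1 %| t)%Z.
  apply: (@dvd_cancel Q1 Q2 t (b1' * a1 - b1 * a1')) => //.
  transitivity ((y * u' - x * v') * (x * u + D * y * v)
    - (y * u - x * v) * (x * u' + D * y * v')); first by rewrite -Nx /t; ring.
  by rewrite A1 B1 A1' B1'; ring.
have s2 : (Q2 %| s)%Z.
  apply: (@dvd_cancel Q2 Q1 s (a2 * a2' + D * b2 * b2')) => //.
  transitivity ((x * u - D * y * v) * (x * u' - D * y * v')
    + D * (x * v + y * u) * (x * v' + y * u')); first by rewrite [Q2 * Q1]mulrC -Nx /s; ring.
  by rewrite A2 B2 A2' B2'; ring.
have t2 : (Q2 %| t)%Z.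
  apply: (@dvd_cancel Q2 Q1 t (b2 * a2' - b2' * a2)) => //.
  transitivity ((x * v + y * u) * (x * u' - D * y * v')
    - (x * v' + y * u') * (x * u - D * y * v)); first by rewrite [Q2 * Q1]mulrC -Nx /t; ring.
  by rewrite A2 B2 A2' B2'; ring.
have M0 : 0 < Q1 * Q2 by rewrite Num.Theory.mulr_gt0.
have /dvdzP[s0 S] : (Q1 * Q2 %| s)%Z by rewrite Gauss_dvdz // s1.
have /dvdzP[t0 T] : (Q1 * Q2 %| t)%Z by rewrite Gauss_dvdz // t1.
have st : s0 ^+ 2 + D * t0 ^+ 2 = 1.
  apply: (mulfI (Num.Theory.lt0r_neq0 (Num.Theory.mulr_gt0 M0 M0))).
  transitivity (s ^+ 2 + D * t ^+ 2); first by rewrite S T; ring.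
  transitivity ((u ^+ 2 + D * v ^+ 2) * (u' ^+ 2 + D * v' ^+ 2)).
    by rewrite /s /t; ring.
  by rewrite Nu Nu' mulr1.
have [t00 s01] := norm_one D1 st.
have E1 : u * (Q1 * Q2) = s * u' - D * t * v' by rewrite -Nu' /s /t; ring.
have E2 : v * (Q1 * Q2) = s * v' + t * u' by rewrite -Nu' /s /t; ring.
have MI := mulIf (Num.Theory.lt0r_neq0 M0).
case: s01 => s01; [left|right]; split; apply: MI;
  by rewrite ?E1 ?E2 S T t00 s01; ring.
Qed.

(** * Existence of partners: Thue's lemma and descent *)

Import Order.TTheory Num.Theory.

Lemma sqr_sub_le (i j L m : nat) : (i <= L)%N -> (j <= L)%N -> (L ^ 2 <= m)%N ->
  (i%:Z - j%:Z) ^+ 2 <= m.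
Proof.
move=> iL jL Lm; wlog ij : i j iL jL / (i <= j)%N.
  by move=> H; case/orP: (leq_total i j) => ij; last rewrite -sqrrN opprB; exact: H.
have [t jt] : exists t, j = (i + t)%N by exists (j - i)%N; lia.
have -> : (i%:Z - j%:Z) ^+ 2 = (t * t)%N by rewrite jt; lia.
have tL : (t <= L)%N by lia.
by have := leq_mul tL tL; rewrite !mulnn; lia.
Qed.

(** Pigeonhole on the (L + 1)^2 > m pairs with entries at most L, the integer part of the square
    root of m. *)
Lemma thue (m : nat) (a b : int) : (0 < m)%N ->
  exists u v : int, [/\ (u != 0) || (v != 0), u ^+ 2 <= m%:Z, v ^+ 2 <= m%:Z
    & (m %| u * a - v * b)%Z].
Proof.
move=> m0; have ex0 : exists L, (L ^ 2 <= m)%N by exists 0%N.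
have bnd L : (L ^ 2 <= m)%N -> (L <= m)%N by move=> Lm; rewrite (leq_trans _ Lm) //; nia.
have [L Lm Lmax] := ex_maxnP ex0 bnd.
have mL : (m < L.+1 ^ 2)%N by rewrite ltnNge; apply/negP => /Lmax; rewrite ltnn.
have ltm (z : int) : (`|(z %% m)%Z| < m)%N by lia.
pose f (z : 'I_L.+1 * 'I_L.+1) := Ordinal (ltm (z.1%:Z * a - z.2%:Z * b)).
have /injectivePn[[i j] [[i' j'] ne]] : ~~ injectiveb f.
  apply/negP => /injectiveP /leq_card; rewrite card_prod !card_ord leqNgt.
  by rewrite mulnn mL.
move=> /(congr1 val) /= fE; exists (i%:Z - i'%:Z), (j%:Z - j'%:Z); split.
- rewrite !subr_eq0; case: eqVneq => //= -[ii]; apply/eqP => -[jj].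
  by move: ne; rewrite (val_inj ii) (val_inj jj) eqxx.
- by apply: sqr_sub_le Lm; rewrite -ltnS.
- by apply: sqr_sub_le Lm; rewrite -ltnS.
have /eqP : ((i%:Z * a - j%:Z * b) %% m = (i'%:Z * a - j'%:Z * b) %% m)%Z by lia.
rewrite eqz_mod_dvd; congr (_ %| _)%Z; ring.
Qed.

Lemma coprime_norm (D m : nat) (x y : int) :
  coprimez x y -> x ^+ 2 + D%:Z * y ^+ 2 = m -> coprimez m y.
Proof.
move=> xy <-; rewrite coprimez_sym /coprimez.
have -> : x ^+ 2 + D%:Z * y ^+ 2 = (D%:Z * y) * y + x ^+ 2 by ring.
by rewrite gcdzMDl -/(coprimez _ _) coprimezXr // coprimez_sym.
Qed.

(* Twisting the square root x / y of -D modulo m by a square root e of 1: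
   the descent from c * m to m works because the multiples c <= D which are
   norms compatible with m = 1 mod 3 are 1, 4 and D. *)
Lemma norm_twist (D m : nat) (x y e : int) : D = 2%N \/ D = 6 ->
  odd m -> (m %% 3 = 1)%N -> (forall k, k ^ 2 != m)%N -> coprimez x y ->
  x ^+ 2 + D%:Z * y ^+ 2 = m -> (m %| e ^+ 2 - 1)%Z ->
  exists u v : int, u ^+ 2 + D%:Z * v ^+ 2 = m /\ (m %| u * y - e * x * v)%Z.
Proof.
move=> D26 modd m3 nsq xy Nx e1.
have m0 : (0 < m)%N by case: (m) modd.
have my : coprimez m y by exact: coprime_norm Nx.
have [u [v [uv um vm uvm]]] := thue y (e * x) m0.
(* Modulo m, u / v is e x / y, whose square is -D. *)
have /dvdzP[c cE] : (m %| u ^+ 2 + D%:Z * v ^+ 2)%Z.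
  rewrite -(@Gauss_dvdzr m (y ^+ 2)) ?coprimezXr //.
  have -> : y ^+ 2 * (u ^+ 2 + D%:Z * v ^+ 2) =
    (u * y - v * (e * x)) * (u * y + v * (e * x)) + (e ^+ 2 - 1) * (v * x) ^+ 2
    + (x ^+ 2 + D%:Z * y ^+ 2) * v ^+ 2 by ring.
  by rewrite Nx !rpredD // dvdz_mulr.
have mp : 0 < m%:Z by [].
have D0 : 0 < D%:Z by case: D26 => ->.
have c0 : 0 < c.
  have u_ge0 := sqr_ge0 u; have v_ge0 : 0 <= D%:Z * v ^+ 2 by rewrite pmulr_rge0 ?sqr_ge0.
  rewrite -(pmulr_lgt0 _ mp) -cE lt0r paddr_eq0 // addr_ge0 // andbT.
  by rewrite [D%:Z * _ == 0]mulf_eq0 !sqrf_eq0 (gt_eqF D0) negb_and.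
(* Since m is not a square, u^2 < m, so the norm is less than (D + 1) m. *)
have cD : c <= D%:Z.
  rewrite -ltzD1 -(ltr_pM2r mp) -cE mulrDl mul1r addrC.
  rewrite ler_ltD // ?ler_pM2l // lt_neqAle um andbT.
  by apply/eqP => uE; case/negP: (nsq `|u|%N); rewrite -abszX uE.
have descend u1 v1 k : 0 < k -> coprimez m k ->
    u ^+ 2 + D%:Z * v ^+ 2 = k * (u1 ^+ 2 + D%:Z * v1 ^+ 2) -> c = k ->
    (m %| k * (u1 * y - e * x * v1))%Z ->
    exists u v : int, u ^+ 2 + D%:Z * v ^+ 2 = m /\ (m %| u * y - e * x * v)%Z.
  move=> k0 mk E ck mE; exists u1, v1; split; last by rewrite -(Gauss_dvdzr _ mk).
  by apply: (mulfI (lt0r_neq0 k0)); rewrite -E cE ck.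
have m2 : coprimez m 2 by rewrite coprimezE /= coprimen2.
have m_3 : coprimez m 3 by rewrite coprimezE /= coprime_sym prime_coprime // /dvdn m3.
(* Division by sqrt(-D): the quotient of D w + v sqrt(-D) is v - w sqrt(-D). *)
have descendD w : coprimez m D -> c = D%:Z -> u = D%:Z * w ->
    exists u v : int, u ^+ 2 + D%:Z * v ^+ 2 = m /\ (m %| u * y - e * x * v)%Z.
  move=> mD cDE uw; apply: (descend v (- w) D%:Z) => //; first by rewrite uw; ring.
  rewrite -(Gauss_dvdzr _ my) (_ : _ * _ = e * x * (u * y - v * (e * x))
    + (e ^+ 2 - 1) * (x ^+ 2 * v) + (x ^+ 2 + D%:Z * y ^+ 2) * v); last first.
    by rewrite uw; ring.
  by rewrite Nx !rpredD //; [exact: dvdz_mull | exact: dvdz_mulr | exact: dvdz_mulr].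
have uvm1 : (m %| 1 * (u * y - e * x * v))%Z.
  by rewrite mul1r [e * x * v]mulrC.
have [n mn] : exists n : nat, m = (3 * n + 1)%N.
  by exists (m %/ 3)%N; rewrite {1}(divn_eq m 3) m3 mulnC.
case: D26 => DE.
  have [c1|c2] : c = 1 \/ c = 2 by clear - c0 cD DE; lia.
    by apply: (descend u v 1) => //; rewrite ?mul1r // /coprimez gcdz1.
  have [w [uw|uw]] : exists w : int, u = 2 * w \/ u = 2 * w + 1.
    by exists (u %/ 2)%Z; clear; lia.
    by apply: (descendD w); rewrite ?DE.
  by exfalso; move: cE; rewrite uw c2 DE; clear; lia.
have res2 (z : int) : exists w : int, z = 2 * w \/ z = 2 * w + 1.
  by exists (z %/ 2)%Z; clear; lia.
have res3 (z : int) : exists w : int, [\/ z = 3 * w, z = 3 * w + 1 | z = 3 * w + 2].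
  exists (z %/ 3)%Z; have : z = 3 * (z %/ 3)%Z \/ z = 3 * (z %/ 3)%Z + 1 \/
    z = 3 * (z %/ 3)%Z + 2 by clear; lia.
  by case=> [|[]] ?; [constructor 1|constructor 2|constructor 3].
have [w2 u2] := res2 u; have [w3 u3] := res3 u.
have : c = 1 \/ c = 4 \/ c = 6 \/ c = 2 \/ c = 5 \/ c = 3 by clear - c0 cD DE; lia.
case=> [c1|[c4|[c6|c235]]].
- by apply: (descend u v 1) => //; rewrite ?mul1r // /coprimez gcdz1.
- have [z2 v2] := res2 v.
  have {}u2 : u = 2 * w2.
    by case: u2 => // u2; exfalso; move: cE; rewrite u2 c4 DE; clear; lia.
  have {}v2 : v = 2 * z2.
    by case: v2 => // v2; exfalso; move: cE; rewrite u2 v2 c4 DE; clear; lia.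
  apply: (descend w2 z2 4) => //; first by rewrite (_ : 4 = 2 ^+ 2) // coprimezXr.
    by rewrite u2 v2; ring.
  have -> : 4 * (w2 * y - e * x * z2) = 2 * (u * y - v * (e * x)) by rewrite u2 v2; ring.
  exact: dvdz_mull.
- have {}u2 : u = 2 * w2.
    by case: u2 => // u2; exfalso; move: cE; rewrite u2 c6 DE; clear; lia.
  have {}u3 : u = 3 * w3.
    by case: u3 => // u3; exfalso; move: cE; rewrite u3 c6 DE; clear; lia.
  apply: (descendD (w2 - w3)); rewrite ?DE //; last by clear - u2 u3; lia.
  by rewrite (_ : Posz 6 = 2 * 3) // coprimezMr m2 m_3.
(* With m = 1 modulo 3, c = 2 or 5 would make u^2 = 2 modulo 3, and c = 3 would give 3 | u and then
   2 v^2 = 1 modulo 3. *)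
have [z3 v3] := res3 v.
exfalso; clear - cE c235 u3 v3 DE mn; move: cE; rewrite DE mn => {DE mn}.
by case: c235 => [|[]] ->; case: u3 => ->; case: v3 => ->; lia.
Qed.

(** * Representations by x^2 + 2y^2 and x^2 + 6y^2 come in pairs *)

Section Pairing.
Variables (D Q1 Q2 : nat).
Hypotheses (D26 : D = 2%N \/ D = 6) (Q12 : coprime Q1 Q2).
Hypotheses (oddQ1 : odd Q1) (oddQ2 : odd Q2).
Hypotheses (Q1mod3 : (Q1 %% 3 = 2)%N) (Q2mod3 : (Q2 %% 3 = 2)%N).

Let M := (Q1 * Q2)%N.

Let nonsquare x : (x ^ 2 != M)%N.
Proof.
apply/eqP => xM; have [r /esym /eqP] := coprime_mul_sqr Q12 (esym xM).
by rewrite (negPf (sqr_neq_mod3 _ Q1mod3)).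
Qed.

(** Modulo K1 the twist e is 1, so u / v = x / y; modulo K2 it is -1, so u / v = - x / y. The common
    factor g^2 makes up for what K1 and K2 lack of Q1 and Q2. *)
Lemma paired_of_twist (K1 K2 m g : nat) (x y e u v : int) :
  coprimez x y -> x ^+ 2 + D%:Z * y ^+ 2 = m -> (K1 %| m)%N -> (K2 %| m)%N ->
  (Q1 %| g ^ 2 * K1)%N -> (Q2 %| g ^ 2 * K2)%N ->
  (K1 %| e - 1)%Z -> (K2 %| e + 1)%Z -> (m %| u * y - e * x * v)%Z ->
  paired D Q1 Q2 (x * g) (y * g) (u * g) (v * g).
Proof.
move=> xy Nx K1m K2m Q1K Q2K e1 e2 uv.
have my := coprime_norm xy Nx.
have K1y : coprimez K1 y by rewrite coprimez_sym; apply: coprimez_dvdr K1m _; rewrite coprimez_sym.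
have K2y : coprimez K2 y by rewrite coprimez_sym; apply: coprimez_dvdr K2m _; rewrite coprimez_sym.
have uv1 : (K1 %| u * y - e * x * v)%Z by apply: dvdz_trans uv.
have uv2 : (K2 %| u * y - e * x * v)%Z by apply: dvdz_trans uv.
have K1m' : (K1 %| m%:Z)%Z by [].
have K2m' : (K2 %| m%:Z)%Z by [].
have scale (Q K : nat) (z : int) : (Q %| g ^ 2 * K)%N -> (K %| z)%Z -> (Q %| g%:Z ^+ 2 * z)%Z.
  move=> QK /dvdzP[w ->]; rewrite (_ : _ * _ = w * (g ^ 2 * K)%N); last first.
    by rewrite PoszM; ring.
  exact: dvdz_mull.
apply/and4P; split.
- rewrite (_ : _ + _ = g%:Z ^+ 2 * (x * u + D%:Z * y * v)); last by ring.
  apply: scale Q1K _; rewrite -(Gauss_dvdzr _ K1y).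
  rewrite (_ : _ * _ = x * (u * y - e * x * v) + (e - 1) * (x ^+ 2 * v)
    + (x ^+ 2 + D%:Z * y ^+ 2) * v); last by ring.
  by rewrite Nx !rpredD //; [exact: dvdz_mull|exact: dvdz_mulr|exact: dvdz_mulr].
- rewrite (_ : _ - _ = g%:Z ^+ 2 * ((u * y - e * x * v) + (e - 1) * (x * v))); last by ring.
  by apply: scale Q1K _; rewrite rpredD //; exact: dvdz_mulr.
- rewrite (_ : _ - _ = g%:Z ^+ 2 * (x * u - D%:Z * y * v)); last by ring.
  apply: scale Q2K _; rewrite -(Gauss_dvdzr _ K2y).
  rewrite (_ : _ * _ = x * (u * y - e * x * v) + (e + 1) * (x ^+ 2 * v)
    - (x ^+ 2 + D%:Z * y ^+ 2) * v); last by ring.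
  by rewrite Nx rpredB ?rpredD //; [exact: dvdz_mull|exact: dvdz_mulr|exact: dvdz_mulr].
- rewrite (_ : _ + _ = g%:Z ^+ 2 * ((u * y - e * x * v) + (e + 1) * (x * v))); last by ring.
  by apply: scale Q2K _; rewrite rpredD //; exact: dvdz_mulr.
Qed.

(** Divide by g = gcd(x, y), twist the primitive representation with [norm_twist], and multiply by g
    again. Taking absolute values leaves the sign of v open, hence the disjunction. *)
Lemma paired_exists (x y : nat) : (0 < x)%N -> (0 < y)%N ->
  (x ^ 2 + D * y ^ 2 = M)%N ->
  exists u v : nat, [/\ (0 < u)%N, (0 < v)%N, (u ^ 2 + D * v ^ 2 = M)%N
    & paired D Q1 Q2 x y u v || paired D Q1 Q2 x y u (- v%:Z)].
Proof.
move=> x0 y0 Nx; pose g := gcdn x y.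
have g0 : (0 < g)%N by rewrite gcdn_gt0 x0.
have [x' xg] : exists k, x = (k * g)%N by apply/dvdnP; exact: dvdn_gcdl.
have [y' yg] : exists k, y = (k * g)%N by apply/dvdnP; exact: dvdn_gcdr.
have xy' : coprime x' y'.
  by rewrite /coprime -(eqn_pmul2r g0) mul1n muln_gcdl -xg -yg.
pose m := (x' ^ 2 + D * y' ^ 2)%N.
have Mm : M = (g ^ 2 * m)%N by rewrite -Nx xg yg !expnMn /m; ring.
have oddm : odd m.
  have : odd M by rewrite oddM oddQ1.
  by rewrite Mm oddM => /andP[].
have m3 : (m %% 3 = 1)%N.
  have : (M %% 3 = 1)%N by rewrite -modnMm Q1mod3 Q2mod3.
  by rewrite Mm -modnMml sqrn_mod3; case: (3 %| g)%N; rewrite ?mul0n ?mul1n ?mod0n.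
have nsq k : (k ^ 2)%N != m.
  by apply: contraNneq (nonsquare (g * k)) => km; rewrite expnMn km Mm.
pose K1 := gcdn Q1 m; pose K2 := gcdn Q2 m.
have mK : (m %| K1 * K2)%N.
  rewrite muln_gcdl dvdn_gcd [X in _ && X]dvdn_mulr // andbT.
  by rewrite muln_gcdr dvdn_gcd [X in _ && X]dvdn_mull // andbT -/M Mm dvdn_mull.
have Q1K : (Q1 %| g ^ 2 * K1)%N.
  by rewrite muln_gcdr dvdn_gcd [X in X && _]dvdn_mull // -Mm dvdn_mulr.
have Q2K : (Q2 %| g ^ 2 * K2)%N.
  by rewrite muln_gcdr dvdn_gcd [X in X && _]dvdn_mull // -Mm dvdn_mull.
have /coprimezP[[a b] /= ab] : coprimez K1 K2.
  rewrite coprimezE /=; apply: coprime_dvdl (dvdn_gcdl _ _) _.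
  exact: coprime_dvdr (dvdn_gcdl _ _) Q12.
(* By the Bezout relation a K1 + b K2 = 1, e is 1 modulo K1 and -1 modulo K2. *)
pose e : int := b * K2 - a * K1.
have e1 : (K1 %| e - 1)%Z.
  have -> : e - 1 = (- 2 * a) * K1 by rewrite -[X in e - X]ab /e; ring.
  exact: dvdz_mull.
have e2 : (K2 %| e + 1)%Z.
  have -> : e + 1 = (2 * b) * K2 by rewrite -[X in e + X]ab /e; ring.
  exact: dvdz_mull.
have ee : (m %| e ^+ 2 - 1)%Z.
  rewrite (_ : _ - _ = (e - 1) * (e + 1)); last by ring.
  apply: (@dvdz_trans (K1%:Z * K2%:Z)); first by rewrite -PoszM.
  exact: dvdz_mul.
have Nx' : x'%:Z ^+ 2 + D%:Z * y'%:Z ^+ 2 = m by rewrite /m PoszD PoszM.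
have [u [v [Nu uv]]] := norm_twist D26 oddm m3 nsq (xy' : coprimez x' y') Nx' ee.
have P := paired_of_twist (xy' : coprimez x' y') Nx' (dvdn_gcdr _ _) (dvdn_gcdr _ _)
  Q1K Q2K e1 e2 uv.
have pm (z : int) : `|z|%N = z :> int \/ `|z|%N = - z :> int by clear; lia.
have abs2 (z : int) : `|z|%N%:Z ^+ 2 = z ^+ 2 by case: (pm z) => ->; rewrite ?sqrrN.
have Nu' : (`|u| ^ 2 + D * `|v| ^ 2 = m)%N.
  by apply/eqP; rewrite -eqz_nat PoszD PoszM -Nu -(abs2 u) -(abs2 v).
(* If u = 0 then m would be even, as D is; if v = 0 then m would be a square. *)
have u0 : (0 < `|u|)%N.
  rewrite lt0n; apply/negP => /eqP u0; move: oddm; rewrite -Nu' u0 add0n oddM.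
  by case: D26 => ->.
have v0 : (0 < `|v|)%N.
  by rewrite lt0n; apply/negP => /eqP v0; case/negP: (nsq `|u|%N); rewrite -Nu' v0 muln0 addn0.
exists (`|u| * g)%N, (`|v| * g)%N; split; rewrite ?muln_gt0 ?u0 ?v0 //.
  by rewrite Mm -Nu' !expnMn; ring.
move: P; rewrite xg yg !PoszM.
case: (pm u) => ->; case: (pm v) => -> P; rewrite -?mulNr ?opprK ?P ?orbT //.
  by rewrite -[X in _ || X]pairedN -!mulNr !opprK P orbT.
by rewrite -pairedN -!mulNr !opprK P.
Qed.

(** Rules out that a representation is its own partner (Q = Q2) or that of its conjugate (Q = Q1).
    Adding and subtracting the norm, and as Q is prime to 2D, Q would divide x^2 and y^2. *)
Lemma norm_neq_conj Q Q' (x y : nat) : coprime Q Q' -> odd Q -> (Q %% 3 = 2)%N ->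
  (x ^ 2 + D * y ^ 2 = Q * Q')%N -> ~~ (Q %| x%:Z * x - D%:Z * y * y)%Z.
Proof.
move=> QQ' oddQ Q3 Nx; apply/negP => Qsub.
have Q_2 : coprimez Q 2 by rewrite coprimezE /= coprimen2.
have Q_3 : coprimez Q 3 by rewrite coprimezE /= coprime_sym prime_coprime // /dvdn Q3.
have QD : coprimez Q D by case: D26 => -> //; rewrite (_ : Posz 6 = 2 * 3) // coprimezMr Q_2.
have Qadd : (Q %| x%:Z * x + D%:Z * y * y)%Z.
  have -> : x%:Z * x + D%:Z * y * y = (Q * Q')%N by rewrite -Nx PoszD !PoszM; ring.
  by rewrite PoszM dvdz_mulr.
have Qx : (Q %| x%:Z * x)%Z.
  rewrite -(Gauss_dvdzr _ Q_2) (_ : _ * _ = (x%:Z * x - D%:Z * y * y)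
    + (x%:Z * x + D%:Z * y * y)); first by rewrite rpredD.
  by ring.
have Qy : (Q %| y%:Z * y)%Z.
  rewrite -(Gauss_dvdzr _ QD) (_ : _ * _ = (x%:Z * x + D%:Z * y * y)
    - x%:Z * x); first by rewrite rpredB.
  by ring.
by apply: (@dvd_sqrs_absurd D Q Q' x y).
Qed.

Lemma even_size_reps : ~~ odd (size (reps D M)).
Proof.
have D0 : (0 < D)%N by case: D26 => ->.
(* Entries of [reps] are positive, so partners are taken up to conjugation. *)
pose r (z w : nat * nat) := paired D Q1 Q2 z.1 z.2 w.1 w.2
  || paired D Q1 Q2 z.1 z.2 w.1 (- w.2%:Z).
apply: (@even_size_pairing _ r); first exact: reps_uniq.
- by move=> [x y] [u v] _ _; rewrite /r /= paired_sym paired_conj.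
- move=> [x y]; rewrite mem_reps // => /and3P[_ _ /eqP Nx]; rewrite /r /= negb_or.
  have Nx' : (x ^ 2 + D * y ^ 2 = Q2 * Q1)%N by rewrite Nx /M mulnC.
  have cop : coprime Q2 Q1 by rewrite coprime_sym.
  apply/andP; split; apply/negP => /and4P[h1 _ h3 _].
    by move: h3; apply/negP; exact: norm_neq_conj Nx'.
  by move: h1; rewrite mulrN; apply/negP; exact: norm_neq_conj Nx.
- move=> [x y]; rewrite mem_reps // => /and3P[x0 y0 /eqP Nx].
  have [u [v [u0 v0 Nu P]]] := paired_exists x0 y0 Nx.
  by exists (u, v) => //; rewrite mem_reps // u0 v0 Nu eqxx.
move=> [x y] [u v] [u' v']; rewrite !mem_reps //.
move=> /and3P[x0 y0 /eqP Nx] /and3P[u0 v0 /eqP Nu] /and3P[u0' v0' /eqP Nu'].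
have norm (a b : nat) : (a ^ 2 + D * b ^ 2 = M)%N -> a%:Z ^+ 2 + D%:Z * b%:Z ^+ 2 = Q1%:Z * Q2.
  by move=> E; rewrite -PoszM -[(_ * _)%N]/M -E PoszD PoszM.
have normN (a b : nat) : (a ^ 2 + D * b ^ 2 = M)%N ->
  a%:Z ^+ 2 + D%:Z * (- b%:Z) ^+ 2 = Q1%:Z * Q2 by move=> E; rewrite sqrrN norm.
have D1 : 1 < D%:Z by case: D26 => ->.
have Q10 : 0 < Q1%:Z by case: (Q1) oddQ1.
have Q20 : 0 < Q2%:Z by case: (Q2) oddQ2.
have F (b b' : int) : u%:Z ^+ 2 + D%:Z * b ^+ 2 = Q1%:Z * Q2 ->
    u'%:Z ^+ 2 + D%:Z * b' ^+ 2 = Q1%:Z * Q2 ->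
    paired D Q1 Q2 x y u b -> paired D Q1 Q2 x y u' b' -> u = u' /\ b = b'.
  move=> Nb Nb' P P'.
  have [[[-> ->] //]|[uu _]] := paired_fun D1 Q10 Q20 Q12 (norm _ _ Nx) Nb Nb' P P'.
  by exfalso; clear - uu u0 u0'; lia.
rewrite /r /= => /orP[] P /orP[] P'.
- by have [-> [->]] := F _ _ (norm _ _ Nu) (norm _ _ Nu') P P'.
- by have [-> E] := F _ _ (norm _ _ Nu) (normN _ _ Nu') P P'; exfalso; clear - E v0 v0'; lia.
- by have [-> E] := F _ _ (normN _ _ Nu) (norm _ _ Nu') P P'; exfalso; clear - E v0 v0'; lia.
- by have [-> /oppr_inj [->]] := F _ _ (normN _ _ Nu) (normN _ _ Nu') P P'.
Qed.

End Pairing.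

(** * The residue of p modulo 3 and the form x^2 + 3y^2 *)

Section LegendreMinusThree.
Variable p : nat.
Hypotheses (pp : prime p) (p5 : (5 <= p)%N) (leg : legendre (- 3) p = - 1).

Let not_square (x : 'F_p) : x ^+ 2 != - 3.
Proof.
apply/negP => x3; move: leg; rewrite /legendre; case: ifP => // _; case: ifP => //.
by move=> /existsP[]; exists x; rewrite rmorphN.
Qed.

(** If p = 3k + 1, a value w = x^k other than 1 is a primitive cube root of unity, and (2w + 1)^2 =
    -3. Otherwise X^k - 1 has all 3k nonzero elements as roots. *)
Lemma legendre_m3_mod3 : (p %% 3 = 2)%N.
Proof.
have [p1|p1] := eqVneq (p %% 3)%N 1%N; last first.
  have : ~~ (3 %| p)%N by rewrite dvdn_prime2 //; apply/eqP => p3; move: p5; rewrite -p3.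
  by rewrite /dvdn; lia.
pose k := (p %/ 3)%N; have pk : p = (3 * k).+1 by rewrite /k; lia.
have k0 : (0 < k)%N by lia.
have rootsX (x : 'F_p) : x != 0 -> x ^+ k = 1.
  move=> x0; apply/eqP; rewrite -subr_eq0; apply/negPn/negP => xk.
  have xk3 : (x ^+ k) ^+ 3 = 1.
    apply: (mulfI x0); rewrite -exprM -exprS mulnC -pk mulr1.
    by rewrite -[X in _ ^+ X](card_Fp pp) expf_card.
  have w0 : x ^+ k * x ^+ k + x ^+ k + 1 = 0.
    by apply: (mulfI xk); rewrite mulr0 -(subrr 1) -{3}xk3; ring.
  case/negP: (not_square (2 * x ^+ k + 1)); apply/eqP.
  transitivity (4 * (x ^+ k * x ^+ k + x ^+ k + 1) - 3); first by ring.
  by rewrite w0 mulr0 add0r.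
have X0 : ('X^k - 1 : {poly 'F_p}) != 0 by rewrite monic_neq0 // monicXnsubC.
have := max_poly_roots X0 (_ : all _ (enum [pred x : 'F_p | x != 0])) (enum_uniq _).
rewrite size_XnsubC // -cardE => H.
have : (#|[pred x : 'F_p | x != 0%R]| < k.+1)%N.
  apply: H; apply/allP => x; rewrite mem_enum inE => x0.
  by rewrite rootE !hornerE rootsX // subrr.
have := cardC1 (0 : 'F_p); rewrite card_Fp // => -> ; lia.
Qed.

Lemma dvd_norm3 x y : (p %| x ^ 2 + 3 * y ^ 2)%N -> (p %| x)%N && (p %| y)%N.
Proof.
have pz z : (z%:R == 0 :> 'F_p) = (p %| z)%N by rewrite -(dvdn_pcharf (pchar_Fp pp)).
rewrite -!pz natrD natrM !natrX => /eqP xy.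
have [y0|y0] := eqVneq (y%:R : 'F_p) 0.
  by move: xy; rewrite y0 expr0n mulr0 addr0 andbT => /eqP; rewrite expf_eq0.
case/negP: (not_square (x%:R / y%:R)); apply/eqP.
rewrite expr_div_n (_ : x%:R ^+ 2 = - 3 * y%:R ^+ 2).
  by rewrite mulfK // expf_eq0.
by apply/eqP; rewrite -subr_eq0 mulNr opprK xy.
Qed.

(** Descent: p divides x and y, so p^2 can be cancelled until p k remains, where p^2 | p k
    contradicts the choice of k. *)
Lemma norm3_val_odd a k x y : ~~ (p %| k)%N -> (x ^ 2 + 3 * y ^ 2 != p ^ (2 * a + 1) * k)%N.
Proof.
move=> pk; have p0 := prime_gt0 pp; elim: a x y => [|a IH] x y; apply/eqP => E.
  have /dvd_norm3/andP[/dvdnP[x' xE] /dvdnP[y' yE]] : (p %| x ^ 2 + 3 * y ^ 2)%N.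
    by rewrite E expn1 dvdn_mulr.
  case/negP: pk; apply/dvdnP; exists (x' ^ 2 + 3 * y' ^ 2)%N; apply/eqP.
  by rewrite -(eqn_pmul2l p0) -[X in X == _]/(p ^ (2 * 0 + 1) * k)%N -E xE yE; apply/eqP; ring.
have /dvd_norm3/andP[/dvdnP[x' xE] /dvdnP[y' yE]] : (p %| x ^ 2 + 3 * y ^ 2)%N.
  by rewrite E addn1 expnS -mulnA dvdn_mulr.
case/negP: (IH x' y'); rewrite -(eqn_pmul2l (_ : 0 < p ^ 2)%N) ?expn_gt0 ?p0 //.
by rewrite mulnA -expnD (_ : 2 + (2 * a + 1) = 2 * a.+1 + 1)%N -?E ?xE ?yE; [apply/eqP; ring|lia].
Qed.

End LegendreMinusThree.

Theorem theorem3p7 (p m alpha n i : nat) :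
  prime p -> (5 <= p)%N -> legendre (- 3) p = - 1 ->
  (1 <= i <= p - 1)%N ->
  (schur9 (8 * m + 1)
     (18 * p ^ (2 * alpha + 2) * n
      + 3 * (6 * i + p) * p ^ (2 * alpha + 1))%N = 0 %[mod 16])%Z.
Proof.
move=> pp p5 leg /andP[i0 ip]; have p3 := legendre_m3_mod3 pp p5 leg.
have oddp : odd p by apply: (contraLR _ p5) => /negPf ev; have [->//|] := even_prime pp; rewrite ev.
(* The index is 3 Q1 Q2. As p >= 5 and 0 < i < p, p does not divide 6i, so Q1 and Q2 are coprime. *)
set Q1 := (p ^ (2 * alpha + 1))%N; pose Q2 := (6 * (p * n + i) + p)%N.
have pQ2 : ~~ (p %| Q2)%N.
  rewrite /Q2 dvdn_addl // mulnDr mulnCA (dvdn_addr _ (dvdn_mulr _ (dvdnn p))).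
  rewrite Euclid_dvdM // negb_or; apply/andP; split; last by rewrite gtnNdvd //; lia.
  apply/negP => p6; have p_le6 := dvdn_leq (isT : 0 < 6)%N p6.
  have [pE|pE] : p = 5%N \/ p = 6%N by clear - p5 p_le6; lia.
    by move: p6; rewrite pE.
  by move: pp; rewrite pE.
have cop : coprime Q1 Q2 by rewrite coprimeXl // prime_coprime.
have oddQ1 : odd Q1 by rewrite oddX oddp orbT.
have oddQ2 : odd Q2 by rewrite oddD oddM.
have Q13 : (Q1 %% 3 = 2)%N.
  by rewrite /Q1 -modnXm p3 addn1 expnS expnM -modnMmr -modnXm /= exp1n.
have Q23 : (Q2 %% 3 = 2)%N by rewrite /Q2; lia.
have -> : (18 * p ^ (2 * alpha + 2) * n + 3 * (6 * i + p) * Q1 = 3 * (Q1 * Q2))%N.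
  by rewrite addn2 expnS -(addn1 (2 * alpha)) -/Q1 /Q2; ring.
apply/eqP; rewrite eqz_mod_dvd subr0; apply: schur9_mod16.
- by rewrite oddM oddQ1.
- by rewrite -modnMm Q13 Q23.
- move=> x; apply/eqP => xQ; have [r /esym/eqP] := coprime_mul_sqr cop (esym xQ).
  by rewrite (negPf (sqr_neq_mod3 _ Q13)).
- by apply: even_size_reps => //; left.
(* For D = 3 the list is empty: p divides Q1 Q2 to an odd power. *)
- case E : (reps 3 (Q1 * Q2)) => [//|[x y] s].
  have : (x, y) \in reps 3 (Q1 * Q2) by rewrite E inE eqxx.
  by rewrite mem_reps // => /and3P[_ _]; rewrite (negPf (norm3_val_odd pp p5 leg _ _ _ pQ2)).
- by apply: even_size_reps => //; right.
Qed.
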